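(* A function from the pairs of a finite linear order into the nonnegative integers satisfies condition (!) if and only if it is equivalent to the signature of some element of $\mathcal{S}$; i.e. the class of (equivalence classes of) functions satisfying (!) is exactly the set of signatures of elements of $\mathcal{S}$. Moreover, if $A\in\mathcal{S}$, then the signature of the rotation $A^\circ$ is (equivalent to) the rotation of the signature of $A$.
   Context: Standard generating sets: $\mathrm{Homeo}_+(I)$ acts on $I=[0,1]$ on the right, composition left to right. Support $\mathrm{supt}(f)=\{t:tf\ne t\}$; extended support = interior of its closure; orbitals = components of the support, endpoints = transition points; a bump has exactly one orbital, positive if $tf>t$ there, else negative; the bump of $g$ on an orbital $J$ agrees with $g$ on $J$, identity elsewhere. A marking assigns to each bump $a$ with support $(u,v)$ a point $s_a\in(u,v)$; feet of $a$: $(u,s_a)$ and $[t_a,v)$ with $t_a=s_aa$ ($a$ positive) or $s_aa^{-1}$ ($a$ negative). A marked function has finitely many bumps, each marked. A finite set of marked functions is fast if no bump occurs in two of its elements and distinct bumps have disjoint feet. A standard function is a marked function whose extended support is an interval, with all positive bumps right of all negative bumps, and #positive $-$ #negative bumps $\in\{0,1\}$. For standard $f,g$: $f\ll g$ iff extended supports disjoint with $f$'s to the left; $f\sqsubset g$ iff closure of extended support of $f$ lies in extended support of $g$; $f<g$ iff $f\ll g$ or $f\sqsubset g$. $f^\circ$: if $f$ has $>2$ orbitals, $f$ restricted to the union of its non-extreme orbitals (identity elsewhere, markers inherited); if $f$ has 1 or 2 orbitals and the left foot of its positive bump is $(r,s)$, a positive bump with support $(r,s)$. $(f,g)$ is a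 standard pair if $\{f,g\}$ is fast and either $f\ll g$ or ($f\sqsubset g$ and $(g^\circ,f)$ is a standard pair). $\mathcal{S}$ = finite sets of standard functions, pairwise $<$-comparable, each pair $f<g$ a standard pair; elements $a_0<\dots<a_{n-1}$, greatest $a_{\max}$. Oscillation $o(f,g)$ for $f<g$: number of orbitals of $g$ containing a transition point of $f$. Signature of $A\in\mathcal S$: the function $(f,g)\mapsto o(f,g)$ on pairs $f<g$ of $A$; functions on pairs of finite linear orders are equivalent if an order-preserving bijection of bases carries one to the other. Rotation of $A\in\mathcal S$: $A^\circ=(A\setminus\{a_{\max}\})\cup\{a_{\max}^\circ\}$ if some $i<|A|-1$ has $o(a_i,a_{\max})>0$, else $A^\circ=A\setminus\{a_{\max}\}$ (ordered by $<$). Condition (!): write $r=p\,!\,q$ if $r\ge\min(p-1,q)$ with equality unless $p=q$; a function $\mathsf{A}$ on pairs of a finite linear order satisfies (!) if $\mathsf{A}(a,b)=\mathsf{A}(b,c)\,!\,\mathsf{A}(a,c)$ whenever $a<b<c$. For such $\mathsf{B},\mathsf{C}$, $\mathsf{B}+\mathsf{C}$ has base $B$ followed by $C$, agrees with $\mathsf{B}$, $\mathsf{C}$ on their bases and is $0$ across; $\mathsf{A}$ is indecomposable if it is not $\mathsf{B}+\mathsf{C}$ with both bases nonempty. Rotation of such a function: if the base is empty or a singleton, the rotation has empty base; if $\mathsf{A}=\mathsf{B}+\mathsf{C}$ with nonempty bases, $\mathsf{A}^\circ=\mathsf{B}+\mathsf{C}^\circ$; if $\mathsf{A}$ is indecomposable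 with base $\{0,\dots,n\}$, $n>0$, then $\mathsf{A}^\circ$ has base $\{-1,0,\dots,n-1\}$ (with $-1$ least), $\mathsf{A}^\circ(-1,i)=\mathsf{A}(i,n)-1$ for $0\le i<n$, and $\mathsf{A}^\circ(i,j)=\mathsf{A}(i,j)$ for $0\le i<j<n$. *)

(* Defs.v *)
From Stdlib Require Import Reals Lra Lia ZArith List Permutation Classical ClassicalEpsilon.
Open Scope R_scope.

Definition decP (P : Prop) : bool :=
  if excluded_middle_informative P then true else false.

(* ---------- Homeo_+(I), I = [0,1], acting on the right: t f = f t ---------- *)
Definition inI (t : R) : Prop := 0 <= t <= 1.

(* orientation-preserving homeomorphism of [0,1] (values outside [0,1] are
   irrelevant): a strictly increasing map of [0,1] onto [0,1]. *)
Definition homeo (f : R -> R) : Prop :=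
  (forall x y, 0 <= x -> x < y -> y <= 1 -> f x < f y) /\
  (forall x, inI x -> inI (f x)) /\
  (forall y, inI y -> exists x, inI x /\ f x = y).

Definition supt (f : R -> R) (t : R) : Prop := inI t /\ f t <> t.

Definition closure (S : R -> Prop) (x : R) : Prop :=
  forall e, 0 < e -> exists y, S y /\ Rabs (x - y) < e.
Definition interior (S : R -> Prop) (x : R) : Prop :=
  exists e, 0 < e /\ forall y, Rabs (x - y) < e -> S y.

Definition ext_supt (f : R -> R) : R -> Prop := interior (closure (supt f)).

(* (u,v) is an orbital (a component of the support) of f *)
Definition orbital (f : R -> R) (u v : R) : Prop :=
  0 <= u /\ u < v /\ v <= 1 /\ f u = u /\ f v = v /\
  (forall t, u < t < v -> f t <> t).

Definition pos_on (f : R -> R) (u v : R) : Prop := forall t, u < t < v -> t < f t.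
Definition neg_on (f : R -> R) (u v : R) : Prop := forall t, u < t < v -> f t < t.

(* a marked bump/orbital: support (bu, bv) with marker bs *)
Record morb := MOrb { bu : R; bv : R; bs : R }.

(* a marked function: the homeomorphism together with the list of all of its
   orbitals (finitely many), sorted left to right, each carrying its marker *)
Record MF := MkMF { mf : R -> R; orbs : list morb }.

Definition mf_default : MF := MkMF (fun t => t) nil.
Definition morb_default : morb := MOrb 0 0 0.

Definition marked (f : MF) : Prop :=
  homeo (mf f) /\
  (forall b, In b (orbs f) -> orbital (mf f) (bu b) (bv b) /\ bu b < bs b < bv b) /\
  (forall i j, (i < j < length (orbs f))%nat ->
      bv (nth i (orbs f) morb_default) <= bu (nth j (orbs f) morb_default)) /\
  (forall t, supt (mf f) t -> exists b, In b (orbs f) /\ bu b < t < bv b).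

Definition bumpfun (f : MF) (b : morb) (t : R) : R :=
  if decP (bu b < t < bv b) then mf f t else t.

Definition same_bump (f : MF) (b : morb) (g : MF) (c : morb) : Prop :=
  forall t, inI t -> bumpfun f b t = bumpfun g c t.

Definition rstart (f : MF) (b : morb) (ta : R) : Prop :=
  (pos_on (mf f) (bu b) (bv b) /\ ta = mf f (bs b)) \/
  (neg_on (mf f) (bu b) (bv b) /\ inI ta /\ mf f ta = bs b).

Definition in_foot (f : MF) (b : morb) (t : R) : Prop :=
  (bu b < t < bs b) \/ (exists ta, rstart f b ta /\ ta <= t < bv b).

Definition feet_disjoint (f : MF) (b : morb) (g : MF) (c : morb) : Prop :=
  forall t, ~ (in_foot f b t /\ in_foot g c t).

Definition fast (L : list MF) : Prop :=
  (forall i j b c, (i < length L)%nat -> (j < length L)%nat -> i <> j ->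
     In b (orbs (nth i L mf_default)) -> In c (orbs (nth j L mf_default)) ->
     ~ same_bump (nth i L mf_default) b (nth j L mf_default) c) /\
  (forall i j b c, (i < length L)%nat -> (j < length L)%nat ->
     In b (orbs (nth i L mf_default)) -> In c (orbs (nth j L mf_default)) ->
     ~ same_bump (nth i L mf_default) b (nth j L mf_default) c ->
     feet_disjoint (nth i L mf_default) b (nth j L mf_default) c).

Definition is_interval (S : R -> Prop) : Prop :=
  (exists x, S x) /\ (forall x y z, S x -> S z -> x <= y <= z -> S y).

Definition npos (f : MF) : nat :=
  length (filter (fun b => decP (pos_on (mf f) (bu b) (bv b))) (orbs f)).
Definition nneg (f : MF) : nat :=
  length (filter (fun b => decP (neg_on (mf f) (bu b) (bv b))) (orbs f)).

Definition standard (f : MF) : Prop :=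
  marked f /\
  is_interval (ext_supt (mf f)) /\
  (forall b c, In b (orbs f) -> In c (orbs f) ->
     pos_on (mf f) (bu b) (bv b) -> neg_on (mf f) (bu c) (bv c) -> bv c <= bu b) /\
  (npos f = nneg f \/ npos f = S (nneg f)).

Definition sll (f g : MF) : Prop :=
  forall x y, ext_supt (mf f) x -> ext_supt (mf g) y -> x < y.
Definition ssub (f g : MF) : Prop :=
  forall x, closure (ext_supt (mf f)) x -> ext_supt (mf g) x.
Definition slt (f g : MF) : Prop := sll f g \/ ssub f g.

Definition circ (f h : MF) : Prop :=
  marked h /\
  ( ((2 < length (orbs f))%nat /\
     orbs h = removelast (tl (orbs f)) /\
     (forall t, inI t ->
        ((exists b, In b (orbs h) /\ bu b < t < bv b) -> mf h t = mf f t) /\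
        (~ (exists b, In b (orbs h) /\ bu b < t < bv b) -> mf h t = t)))
  \/
    ((1 <= length (orbs f) <= 2)%nat /\
     exists b m, In b (orbs f) /\ pos_on (mf f) (bu b) (bv b) /\
       orbs h = MOrb (bu b) (bs b) m :: nil /\ pos_on (mf h) (bu b) (bs b)) ).

Inductive std_pair : MF -> MF -> Prop :=
| sp_ll f g : fast (f :: g :: nil) -> sll f g -> std_pair f g
| sp_sub f g h : fast (f :: g :: nil) -> ssub f g -> circ g h -> std_pair h f ->
    std_pair f g.

Definition in_S (A : list MF) : Prop :=
  (forall f, In f A -> standard f) /\
  (forall i j, (i < j < length A)%nat ->
     slt (nth i A mf_default) (nth j A mf_default) /\
     std_pair (nth i A mf_default) (nth j A mf_default)).

Definition endpoints (f : MF) : list R :=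
  flat_map (fun b => bu b :: bv b :: nil) (orbs f).

Definition osc (f g : MF) : nat :=
  length (filter (fun c => decP (exists e, In e (endpoints f) /\ bu c < e < bv c))
                 (orbs g)).

Definition sig (A : list MF) (i j : nat) : nat :=
  osc (nth i A mf_default) (nth j A mf_default).
Definition sigZ (A : list MF) (i j : nat) : Z := Z.of_nat (sig A i j).

Open Scope Z_scope.
Definition bang_rel (r p q : Z) : Prop :=
  r >= Z.min (p - 1) q /\ (p <> q -> r = Z.min (p - 1) q).

(* functions on pairs of the finite linear order {0,...,n-1} *)
Definition bang (n : nat) (F : nat -> nat -> nat) : Prop :=
  forall a b c, (a < b < c)%nat -> (c < n)%nat ->
    bang_rel (Z.of_nat (F a b)) (Z.of_nat (F b c)) (Z.of_nat (F a c)).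

Definition splitpt (n : nat) (F : nat -> nat -> nat) (k : nat) : Prop :=
  (0 < k < n)%nat /\ forall i j, (i < k)%nat -> (k <= j < n)%nat -> F i j = 0%nat.

(* rotrel n F n' G : G (on {0..n'-1}) is the rotation of F (on {0..n-1});
   in the indecomposable case the new least element -1 is placed at 0. *)
Inductive rotrel : nat -> (nat -> nat -> nat) -> nat -> (nat -> nat -> Z) -> Prop :=
| rot_small n F G : (n <= 1)%nat -> rotrel n F 0 G
| rot_indec n F G : (2 <= n)%nat -> (forall k, ~ splitpt n F k) ->
    (forall i, (i < n - 1)%nat -> G 0%nat (S i) = Z.of_nat (F i (n - 1)%nat) - 1) ->
    (forall i j, (i < j)%nat -> (j < n - 1)%nat -> G (S i) (S j) = Z.of_nat (F i j)) ->
    rotrel n F n G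
| rot_dec n F k m H G : splitpt n F k ->
    rotrel (n - k) (fun i j => F (k + i)%nat (k + j)%nat) m H ->
    (forall i j, (i < j)%nat -> (j < k)%nat -> G i j = Z.of_nat (F i j)) ->
    (forall i j, (i < k)%nat -> (k <= j < k + m)%nat -> G i j = 0) ->
    (forall i j, (i < j)%nat -> (j < m)%nat -> G (k + i)%nat (k + j)%nat = H i j) ->
    rotrel n F (k + m) G.
Close Scope Z_scope.

(* Main.v *)
Require Import Defs.
From Stdlib Require Import Reals ZArith List Permutation.
From Stdlib Require Import Lra Lia Classical ClassicalEpsilon.

(** Three obstacles shape the details. The rotation [circ] is a relation: for a function with at
    most two orbitals the marker of the new bump is free. The two pairs of a triple with the same
    greatest element may therefore come with different rotations of it, and these must be shown
    interchangeable before the cyclic move applies. The identity needs points without coincidences.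
    The orbitals of a standard function tile an interval, so its transition points are the left ends
    of its orbitals and one more point; fastness separates the left ends of two functions because
    left feet begin there. Standard pairs alone do not carry the realization through its induction.
    The new outer bumps have feet reaching up to the ends of h, so the other functions must leave a
    gap in their feet around these ends. Hence the induction keeps a positive distance between the
    ends of each function and the feet of every other one, and confines everything to a prescribed
    interval whose margins receive the outermost feet. *)

(** Everything rests on one identity: if f is nested in g and the rotation g° is
    below f, then o(f,g) = o(g°,f) + 1, because o(f,g) and o(g°,f) count the
    blocks of f-points and of g°-points in the merged sequence of transition
    points, and these blocks alternate.  It turns a triple a < b < c with c above
    both into c° < a < b with smaller oscillations, and condition (!) is invariant
    under this cyclic move, so signatures satisfy (!).  It is also the computation
    of the signature of a rotation.  Conversely an indecomposable function with (!)
    has positive values against its greatest element, so its rotation is again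
    such a function with smaller total; a realization h < a_0 < ... of the rotation
    becomes one of the function when h is replaced by c, obtained from h by adding
    an outer negative bump on the left and an outer positive bump on the right.
    Sums are realized side by side. *)

(** * Counting cells of contiguous chains *)

Lemma decP_true (P : Prop) : P -> decP P = true.
Proof. unfold decP; destruct (excluded_middle_informative P); tauto. Qed.

Lemma decP_false (P : Prop) : ~ P -> decP P = false.
Proof. unfold decP; destruct (excluded_middle_informative P); tauto. Qed.

Lemma decP_iff (P Q : Prop) : (P <-> Q) -> decP P = decP Q.
Proof.
  intros H; unfold decP.
  destruct (excluded_middle_informative P), (excluded_middle_informative Q); tauto.
Qed.

Lemma decP_elim (P : Prop) : decP P = true -> P.
Proof. unfold decP; destruct (excluded_middle_informative P); auto; discriminate. Qed.

(** This is [osc] with the transition points of the first function replaced by an arbitrary set, so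
    that points can be exchanged while the cells stay fixed. *)
Definition cnt (P : R -> Prop) (l : list morb) : nat :=
  length (filter (fun c => decP (exists e, P e /\ bu c < e < bv c)) l).

Lemma cnt_hit P c l e : P e -> bu c < e < bv c -> cnt P (c :: l) = S (cnt P l).
Proof.
  intros H1 H2; unfold cnt; simpl.
  rewrite decP_true by (exists e; tauto); reflexivity.
Qed.

Lemma cnt_miss P c l :
  (forall e, P e -> bu c < e < bv c -> False) -> cnt P (c :: l) = cnt P l.
Proof.
  intros H; unfold cnt; simpl.
  rewrite decP_false by (intros [e He]; exact (H e (proj1 He) (proj2 He))); reflexivity.
Qed.

Lemma cnt_ext P Q l :
  (forall c, In c l ->
     (exists e, P e /\ bu c < e < bv c) <-> (exists e, Q e /\ bu c < e < bv c)) ->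
  cnt P l = cnt Q l.
Proof.
  intros H; unfold cnt; f_equal; apply filter_ext_in.
  intros c Hc; apply decP_iff; auto.
Qed.

Lemma cnt_zero P l :
  (forall c e, In c l -> P e -> bu c < e < bv c -> False) -> cnt P l = 0%nat.
Proof.
  induction l as [|c l IH]; intros H; [reflexivity|].
  rewrite cnt_miss by (intros e; apply H; left; reflexivity).
  apply IH; intros d e Hd; apply H; right; exact Hd.
Qed.

Lemma cnt_app P l l' : cnt P (l ++ l') = (cnt P l + cnt P l')%nat.
Proof. unfold cnt; rewrite filter_app, length_app; reflexivity. Qed.

(** Consecutive orbitals share an endpoint; for a standard function this is what an interval as
    extended support amounts to. *)
Fixpoint chain (x : R) (l : list morb) (y : R) : Prop :=
  match l with
  | nil => x = y
  | b :: l' => bu b = x /\ x < bv b /\ chain (bv b) l' y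
  end.

Lemma chain_le x l y : chain x l y -> x <= y.
Proof.
  revert x; induction l as [|b l IH]; simpl; intros x H; [lra|].
  destruct H as (H1 & H2 & H3); apply IH in H3; lra.
Qed.

Lemma chain_lt x l y : chain x l y -> l <> nil -> x < y.
Proof.
  destruct l as [|b l]; simpl; intros H N; [congruence|].
  destruct H as (H1 & H2 & H3); apply chain_le in H3; lra.
Qed.

Lemma chain_in x l y b : chain x l y -> In b l -> x <= bu b /\ bu b < bv b /\ bv b <= y.
Proof.
  revert x; induction l as [|c l IH]; simpl; intros x H K; [tauto|].
  destruct H as (H1 & H2 & H3), K as [<- | K].
  - apply chain_le in H3; lra.
  - pose proof (IH _ H3 K); lra.
Qed.

Lemma chain_app x l l' y :
  chain x (l ++ l') y <-> exists z, chain x l z /\ chain z l' y.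
Proof.
  revert x; induction l as [|b l IH]; simpl; intros x.
  - split; [intros H; exists x; auto | intros (z & -> & H); auto].
  - split.
    + intros (H1 & H2 & H3); apply IH in H3; destruct H3 as (z & H3 & H4).
      exists z; tauto.
    + intros (z & (H1 & H2 & H3) & H4); repeat split; auto.
      apply IH; exists z; auto.
Qed.

Lemma chain_cover x l y z :
  chain x l y -> l <> nil -> x <= z <= y -> exists b, In b l /\ bu b <= z <= bv b.
Proof.
  revert x; induction l as [|b l IH]; simpl; intros x H N K; [congruence|].
  destruct H as (H1 & H2 & H3).
  destruct (Rle_lt_dec z (bv b)) as [L|L]; [exists b; split; [auto|lra]|].
  destruct l as [|c l].
  - simpl in H3; lra.
  - destruct (IH _ H3) as (d & Hd & Kd); [discriminate|lra|].
    exists d; auto.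
Qed.

Lemma chain_pts x l y e :
  chain x l y -> In e (x :: map bv l) -> x <= e <= y /\ (e = y \/ exists b, In b l /\ bu b = e).
Proof.
  revert x; induction l as [|b l IH]; simpl; intros x H K.
  - destruct K as [<-|[]]; subst; split; [lra|auto].
  - destruct H as (H1 & H2 & H3); destruct K as [<-|K].
    + split; [apply chain_le in H3; lra|]. right; exists b; auto.
    + destruct (IH _ H3 K) as [H4 [H5|(d & Hd & Kd)]]; (split; [lra|]); eauto.
Qed.

Lemma chain_end_pt x l y : chain x l y -> In y (x :: map bv l).
Proof.
  revert x; induction l as [|b l IH]; simpl; intros x H; [auto|].
  destruct H as (H1 & H2 & H3); right; apply (IH _ H3).
Qed.

Lemma chain_endpoints x l y e :
  chain x l y -> l <> nil ->
  In e (flat_map (fun b => bu b :: bv b :: nil) l) <-> In e (x :: map bv l).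
Proof.
  revert x; induction l as [|b l IH]; intros x H N; [congruence|].
  destruct H as (H1 & H2 & H3); destruct l as [|c l].
  - simpl; subst; tauto.
  - specialize (IH _ H3 ltac:(discriminate)).
    simpl in IH |- *; rewrite H1; tauto.
Qed.

(** Used with [l] the orbitals of a rotation g° and [b] the last orbital of g: the left ends of all
    orbitals of g but the first are the transition points of g°. *)
Lemma chain_inner x l b y e :
  chain x (l ++ b :: nil) y -> l <> nil ->
  In e (map bu (l ++ b :: nil)) <-> In e (flat_map (fun b => bu b :: bv b :: nil) l).
Proof.
  revert x; induction l as [|c l IH]; intros x H N; [congruence|].
  destruct H as (H1 & H2 & H3); destruct l as [|d l].
  - simpl in H3 |- *; destruct H3 as [H3 _]; rewrite H3; tauto.
  - specialize (IH _ H3 ltac:(discriminate)).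
    simpl in IH, H3 |- *; destruct H3 as [H3 _]; rewrite <- H3; tauto.
Qed.

(* The left-hand side counts the maximal blocks of F-points in the merged
   sequence of transition points, and [cnt _ F] those of G-points; the blocks
   alternate, beginning and ending with F-points. *)
Lemma cnt_interleave G : forall F c x y f0 fM,
  chain x (c :: G) y -> chain f0 F fM -> x < f0 < bv c -> fM < y ->
  (forall d, In d G -> bu d < fM) ->
  (forall d e, In d G -> In e (f0 :: map bv F) -> bu d <> e) ->
  cnt (fun e => In e (f0 :: map bv F)) (c :: G) =
  S (cnt (fun e => In e (map bu G)) F).
Proof.
  induction G as [|d G IHG].
  { intros F c x y f0 fM HG HF H0 HM _ _.
    rewrite (cnt_hit _ c nil f0); [|left; reflexivity|simpl in HG; lra].
    rewrite (cnt_zero _ F); [reflexivity|simpl; tauto]. }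
  induction F as [|b F IHF]; intros c x y f0 fM HG HF H0 HM HlM Hd.
  { simpl in HG, HF; specialize (HlM d (or_introl eq_refl)); lra. }
  pose proof HG as HG0; pose proof HF as HF0.
  destruct HG as (G1 & G2 & G3); pose proof G3 as G30; destruct G3 as (G3 & G4 & G5).
  destruct HF as (F1 & F2 & F3).
  assert (Hne : bu d <> bv b) by (apply Hd; simpl; auto).
  assert (Gin : forall d', In d' G -> bv d <= bu d')
    by (intros d' I; apply (chain_in _ _ _ _ G5 I)).
  assert (Fin : forall b', In b' F -> bv b <= bu b')
    by (intros d' I; apply (chain_in _ _ _ _ F3 I)).
  assert (Fpt : forall e, In e (bv b :: map bv F) -> bv b <= e)
    by (intros e I; apply (chain_pts _ _ _ _ F3 I)).
  destruct (Rlt_le_dec (bv b) (bu d)) as [L|L].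
  - transitivity (cnt (fun e => In e (bv b :: map bv F)) (c :: d :: G)).
    { rewrite (cnt_hit _ c _ f0); [|left; reflexivity|lra].
      rewrite (cnt_hit _ c _ (bv b)); [|left; reflexivity|lra].
      f_equal; apply cnt_ext; intros c' Hc'.
      assert (bv c <= bu c') by apply (chain_in _ _ _ _ G30 Hc').
      split; intros (e & I & K); exists e; (split; [|exact K]).
      - destruct I as [<-|I]; [lra|exact I].
      - right; exact I. }
    rewrite (IHF c x y (bv b) fM HG0 F3 ltac:(lra) HM HlM).
    + f_equal; rewrite (cnt_miss _ b); [reflexivity|].
      intros e I K; simpl in I; destruct I as [<-|I]; [lra|].
      apply in_map_iff in I; destruct I as (d' & <- & I); specialize (Gin _ I); lra.
    + intros d' e I K; apply Hd; [exact I|right; exact K].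
  - assert (L' : bu d < bv b) by lra.
    rewrite (cnt_hit _ c _ f0); [|left; reflexivity|lra].
    rewrite (cnt_hit _ b _ (bu d)); [|left; reflexivity|lra].
    f_equal.
    assert (E : cnt (fun e => In e (map bu (d :: G))) F = cnt (fun e => In e (map bu G)) F).
    { apply cnt_ext; intros b' I; specialize (Fin _ I).
      split; intros (e & J & K); exists e; (split; [|exact K]).
      - destruct J as [<-|J]; [lra|exact J].
      - right; exact J. }
    rewrite E.
    destruct (Rlt_le_dec (bv b) (bv d)) as [M|M].
    (* The next F-point lies in [d]: with [c] and [b] each counted once, the rest is again in the
       initial position. *)
    + transitivity (cnt (fun e => In e (bv b :: map bv F)) (d :: G)).
      { apply cnt_ext; intros c' Hc'.
        assert (bv c <= bu c') by apply (chain_in _ _ _ _ G30 Hc').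
        split; intros (e & I & K); exists e; (split; [|exact K]).
        - destruct I as [<-|I]; [lra|exact I].
        - right; exact I. }
      apply (IHG F d (bv c) y (bv b) fM); auto.
      * lra.
      * intros d' I; apply HlM; right; exact I.
      * intros d' e I K; apply Hd; right; [exact I|exact K].
    + (* no F-point lies in d: merge c and d *)
      destruct G as [|d' G].
      { simpl in G5. apply chain_le in F3. lra. }
      assert (bv d <> bv b).
      { simpl in G5; destruct G5 as [<- _]; apply Hd; simpl; auto. }
      rewrite (cnt_miss _ d).
      2:{ intros e I K; destruct I as [<-|I]; [lra|]. apply Fpt in I; lra. }
      (* The merged cell is only an interval; its marker 0 is a dummy. *)
      specialize (IHG (b :: F) (MOrb x (bv d) 0) x y f0 fM).
      assert (IH : cnt (fun e => In e (f0 :: map bv (b :: F))) (MOrb x (bv d) 0 :: d' :: G) =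
                   S (cnt (fun e => In e (map bu (d' :: G))) (b :: F))).
      { apply IHG; auto.
        - split; [reflexivity|]; split; [simpl; lra|exact G5].
        - simpl; lra.
        - intros d0 I; apply HlM; right; exact I.
        - intros d0 e I K; apply Hd; [right; exact I|exact K]. }
      rewrite (cnt_hit _ (MOrb x (bv d) 0) _ f0) in IH; [|left; reflexivity|simpl; lra].
      rewrite (cnt_hit _ b _ (bu d')) in IH; [|left; reflexivity|simpl in G5; lra].
      injection IH; auto.
Qed.

(** * Marked functions, feet and fast pairs *)

Lemma Rmin_cases a b : (a <= b /\ Rmin a b = a) \/ (b <= a /\ Rmin a b = b).
Proof. unfold Rmin; destruct (Rle_dec a b); [left|right]; split; lra. Qed.

Lemma homeo_le f x y : homeo f -> 0 <= x -> x <= y -> y <= 1 -> f x <= f y.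
Proof.
  intros (H & _) H0 [L|<-] H1; [left; apply H; auto|lra].
Qed.

Lemma homeo_lt_inv f x y : homeo f -> inI x -> inI y -> f x < f y -> x < y.
Proof.
  intros H [X0 X1] [Y0 Y1] L; destruct (Rlt_le_dec x y) as [K|K]; [exact K|].
  apply (homeo_le f) in K; auto; lra.
Qed.

Lemma homeo_le_inv f x y : homeo f -> inI x -> inI y -> f x <= f y -> x <= y.
Proof.
  intros (H & _) [X0 X1] [Y0 Y1] L; destruct (Rle_lt_dec x y) as [K|K]; [exact K|].
  apply H in K; lra.
Qed.

(** A change of sign would produce a fixed point, namely the supremum of the points moved in one
    direction. Monotonicity and surjectivity take the place of continuity. *)
Lemma homeo_orbital_sign f u v :
  homeo f -> orbital f u v -> pos_on f u v \/ neg_on f u v.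
Proof.
  intros Hf (U0 & UV & V1 & Fu & Fv & Hne).
  pose proof Hf as (Hm & HI & Hs).
  destruct (classic (pos_on f u v)) as [P|P]; [auto|].
  destruct (classic (neg_on f u v)) as [N|N]; [auto|].
  exfalso.
  assert (Ey : exists y, u < y < v /\ f y < y).
  { apply NNPP; intros K; apply P; intros t Ht.
    destruct (Rtotal_order t (f t)) as [L|[L|L]]; [exact L|symmetry in L; destruct (Hne t Ht L)|].
    exfalso; eauto. }
  assert (Ex : exists y, u < y < v /\ y < f y).
  { apply NNPP; intros K; apply N; intros t Ht.
    destruct (Rtotal_order t (f t)) as [L|[L|L]]; [exfalso; eauto|symmetry in L; destruct (Hne t Ht L)|exact L]. }
  destruct Ey as (y & Hy & Fy), Ex as (x & Hx & Fx).
  destruct (Rtotal_order x y) as [L|[L|L]]; [|subst; lra|].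
  - destruct (completeness (fun z => x <= z <= y /\ z < f z)) as [s [Su Sl]].
    { exists y; intros z Hz; lra. }
    { exists x; lra. }
    assert (x <= s) by (apply Su; lra).
    assert (s <= y) by (apply Sl; intros z Hz; lra).
    destruct (Rtotal_order s (f s)) as [K|[K|K]].
    + assert (s < y).
      { destruct (Req_dec s y) as [->|]; lra. }
      set (w := (s + Rmin (f s) y) / 2).
      assert (s < w < f s /\ w <= y).
      { unfold w; destruct (Rmin_cases (f s) y) as [[? ->]|[? ->]]; lra. }
      assert (f s < f w) by (apply Hm; lra).
      assert (w <= s) by (apply Su; lra); lra.
    + apply (Hne s); lra.
    + assert (exists z, (x <= z <= y /\ z < f z) /\ f s < z) as (z & Hz & K2).
      { apply NNPP; intros C; assert (s <= f s); [|lra].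
        apply Sl; intros z Hz; destruct (Rle_lt_dec z (f s)); [auto|exfalso; eauto]. }
      assert (z <= s) by (apply Su; lra).
      assert (f z <= f s) by (apply homeo_le; auto; lra). lra.
  - destruct (completeness (fun z => y <= z <= x /\ f z < z)) as [s [Su Sl]].
    { exists x; intros z Hz; lra. }
    { exists y; lra. }
    assert (y <= s) by (apply Su; lra).
    assert (s <= x) by (apply Sl; intros z Hz; lra).
    (* Here points are pushed away from the change of sign, so the argument runs for the inverse
       map, with the preimage [p] of [s] in the role that [f s] had before. *)
    destruct (Hs s) as (p & [P0 P1] & Fp); [split; lra|].
    destruct (Rtotal_order s (f s)) as [K|[K|K]].
    + assert (p < s) by (apply (homeo_lt_inv f); auto; unfold inI; lra).
      assert (exists z, (y <= z <= x /\ f z < z) /\ p < z) as (z & Hz & K2).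
      { apply NNPP; intros C; assert (s <= p); [|lra].
        apply Sl; intros z Hz; destruct (Rle_lt_dec z p); [auto|exfalso; eauto]. }
      assert (z <= s) by (apply Su; lra).
      assert (f p < f z) by (apply Hm; lra). lra.
    + apply (Hne s); lra.
    + assert (s < p) by (apply (homeo_lt_inv f); auto; unfold inI; lra).
      assert (s < x).
      { destruct (Req_dec s x) as [->|]; lra. }
      set (w := (s + Rmin p x) / 2).
      assert (s < w < p /\ w <= x).
      { unfold w; destruct (Rmin_cases p x) as [[? ->]|[? ->]]; lra. }
      assert (f w < f p) by (apply Hm; lra).
      assert (w <= s) by (apply Su; lra). lra.
Qed.

Lemma not_pos_and_neg f u v : u < v -> pos_on f u v -> neg_on f u v -> False.
Proof.
  intros L P N; specialize (P ((u+v)/2) ltac:(lra)); specialize (N ((u+v)/2) ltac:(lra)); lra.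
Qed.

Definition mbump (f : MF) (b : morb) : Prop :=
  orbital (mf f) (bu b) (bv b) /\ bu b < bs b < bv b.

Lemma marked_mbump f b : marked f -> In b (orbs f) -> mbump f b.
Proof. intros (_ & H & _); apply H. Qed.

Lemma rstart_inside f b ta :
  homeo (mf f) -> mbump f b -> rstart f b ta -> bu b < ta < bv b.
Proof.
  intros Hf ((U0 & UV & V1 & Fu & Fv & Hne) & Hs) [[P E]|(N & [T0 T1] & E)].
  - subst; split.
    + specialize (P (bs b) Hs); lra.
    + rewrite <- Fv; apply Hf; lra.
  - split; apply (homeo_lt_inv (mf f)); auto; unfold inI; lra.
Qed.

Lemma in_foot_inside f b t :
  homeo (mf f) -> mbump f b -> in_foot f b t -> bu b < t < bv b.
Proof.
  intros Hf Hb [H|(ta & H & K)].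
  - destruct Hb; lra.
  - pose proof (rstart_inside f b ta Hf Hb H); lra.
Qed.

Lemma pos_on_agree f g u v :
  (forall t, u < t < v -> f t = g t) -> pos_on f u v -> pos_on g u v.
Proof. intros E P t Ht; rewrite <- E; auto. Qed.

Lemma neg_on_agree f g u v :
  (forall t, u < t < v -> f t = g t) -> neg_on f u v -> neg_on g u v.
Proof. intros E P t Ht; rewrite <- E; auto. Qed.

Lemma in_foot_agree f g b t :
  homeo (mf f) -> mbump f b -> (forall t, bu b < t < bv b -> mf f t = mf g t) ->
  in_foot f b t -> in_foot g b t.
Proof.
  intros Hf Hb E [H|(ta & H & K)]; [left; exact H|].
  right; exists ta; split; [|exact K].
  pose proof (rstart_inside f b ta Hf Hb H) as I.
  destruct H as [[P ->]|(N & J & L)].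
  - left; split; [eapply pos_on_agree; eauto|].
    apply E, Hb.
  - right; split; [eapply neg_on_agree; eauto|]; split; [exact J|].
    rewrite <- E; auto.
Qed.

Lemma same_bump_support f g b c :
  mbump f b -> mbump g c -> same_bump f b g c -> bu b < bu c -> False.
Proof.
  intros ((U0 & UV & V1 & Fu & Fv & Hne) & Hs) ((U0' & UV' & V1' & Fu' & Fv' & Hne') & Hs') H L.
  set (t := (bu b + Rmin (bu c) (bv b)) / 2).
  assert (bu b < t < bv b /\ t < bu c) as [T1 T2].
  { unfold t; destruct (Rmin_cases (bu c) (bv b)) as [[? ->]|[? ->]]; lra. }
  specialize (H t ltac:(split; lra)); unfold bumpfun in H.
  rewrite (decP_true (bu b < t < bv b)) in H by auto.
  rewrite (decP_false (bu c < t < bv c)) in H by lra.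
  apply (Hne t); auto.
Qed.

Lemma same_bump_sym f g b c : same_bump f b g c -> same_bump g c f b.
Proof. intros H t I; symmetry; auto. Qed.

Lemma marked_disjoint f b c :
  marked f -> In b (orbs f) -> In c (orbs f) -> b = c \/ bv b <= bu c \/ bv c <= bu b.
Proof.
  intros (_ & _ & H & _) Hb Hc.
  apply (In_nth _ _ morb_default) in Hb; apply (In_nth _ _ morb_default) in Hc.
  destruct Hb as (i & Hi & <-), Hc as (j & Hj & <-).
  destruct (Nat.lt_trichotomy i j) as [L|[->|L]]; [|auto|].
  - right; left; apply H; lia.
  - right; right; apply H; lia.
Qed.

Definition noclash (f g : MF) : Prop :=
  forall b c, In b (orbs f) -> In c (orbs g) -> feet_disjoint f b g c.

(** Distinct bumps of one function have disjoint supports, so only feet of different functions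
    matter. A bump common to both would have two left feet starting at the same point, which
    [noclash] excludes. *)
Lemma fast_pair f g : marked f -> marked g -> fast (f :: g :: nil) <-> noclash f g.
Proof.
  intros Mf Mg; split.
  - intros [H1 H2] b c Hb Hc.
    apply (H2 0%nat 1%nat); simpl; auto.
    apply (H1 0%nat 1%nat); simpl; auto.
  - intros H.
    assert (Hn : forall b c, In b (orbs f) -> In c (orbs g) -> same_bump f b g c -> False).
    { intros b c Hb Hc S.
      pose proof (marked_mbump f b Mf Hb) as Mb; pose proof (marked_mbump g c Mg Hc) as Mc.
      assert (bu b = bu c).
      { destruct (Rtotal_order (bu b) (bu c)) as [L|[L|L]]; [|exact L|]; exfalso.
        - eapply (same_bump_support f g b c); eauto.
        - eapply (same_bump_support g f c b); eauto using same_bump_sym. }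
      set (t := (bu b + Rmin (bs c) (bs b)) / 2).
      assert (bu b < t < bs b /\ t < bs c) as [T1 T2].
      { destruct Mb as [_ Mb], Mc as [_ Mc].
        unfold t; destruct (Rmin_cases (bs c) (bs b)) as [[? ->]|[? ->]]; lra. }
      apply (H b c Hb Hc t); split; left; lra. }
    assert (Hself : forall k b c, marked k -> In b (orbs k) -> In c (orbs k) ->
              ~ same_bump k b k c -> feet_disjoint k b k c).
    { intros k b c Mk Hb Hc N t [T1 T2].
      pose proof (in_foot_inside k b t (proj1 Mk) (marked_mbump _ _ Mk Hb) T1).
      pose proof (in_foot_inside k c t (proj1 Mk) (marked_mbump _ _ Mk Hc) T2).
      destruct (marked_disjoint k b c Mk Hb Hc) as [->|[L|L]]; [|lra|lra].
      apply N; intros s Hs; reflexivity. }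
    split; intros i j b c Hi Hj; simpl in Hi, Hj;
      destruct i as [|[|i]]; try lia; destruct j as [|[|j]]; try lia; simpl.
    + intros _ Hb Hc S; eauto.
    + intros _ Hb Hc S; apply same_bump_sym in S; eauto.
    + intros Hb Hc N; auto.
    + intros Hb Hc N; auto.
    + intros Hb Hc N t [T1 T2]; apply (H c b Hc Hb t); auto.
    + intros Hb Hc N; auto.
Qed.

(** The left foot of [b] starts immediately to the right of [bu b], so [bu b] cannot lie in the left
    foot of [c] or at its left end. Fastness enters the counting of oscillations only in this
    form. *)
Lemma noclash_left f g b c :
  marked f -> marked g -> noclash f g -> In b (orbs f) -> In c (orbs g) ->
  bu c <= bu b -> bs c <= bu b.
Proof.
  intros Mf Mg H Hb Hc L.
  destruct (Rle_lt_dec (bs c) (bu b)) as [K|K]; [exact K|exfalso].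
  destruct (marked_mbump f b Mf Hb) as [_ Mb], (marked_mbump g c Mg Hc) as [_ Mc].
  apply (H b c Hb Hc ((bu b + Rmin (bs b) (bs c)) / 2)).
  destruct (Rmin_cases (bs b) (bs c)) as [[? ->]|[? ->]]; split; left; lra.
Qed.

Lemma marked_split_le f l1 b l2 c :
  marked f -> orbs f = l1 ++ b :: l2 ->
  (In c l1 -> bv c <= bu b) /\ (In c l2 -> bv b <= bu c).
Proof.
  intros (_ & _ & H & _) E; rewrite E in H; split; intros I;
    apply (In_nth _ _ morb_default) in I; destruct I as (i & Hi & <-).
  - specialize (H i (length l1)); rewrite length_app in H; simpl in H.
    rewrite (app_nth1 l1) in H by exact Hi; rewrite nth_middle in H; apply H; lia.
  - specialize (H (length l1) (S (length l1 + i))); rewrite length_app in H; simpl in H.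
    rewrite nth_middle, (app_nth2 l1) in H by lia.
    replace (S (length l1 + i) - length l1)%nat with (S i) in H by lia.
    apply H; lia.
Qed.

(** * Extended supports as intervals *)

Lemma closure_supt_cover f l x y z :
  marked f -> orbs f = l -> chain x l y -> l <> nil -> x <= z <= y ->
  closure (supt (mf f)) z.
Proof.
  intros Mf E C N Hz e He; subst l.
  destruct (chain_cover _ _ _ _ C N Hz) as (b & Hb & K).
  destruct (marked_mbump f b Mf Hb) as [(U0 & UV & V1 & Fu & Fv & Hne) _].
  assert (W : exists w, bu b < w < bv b /\ Rabs (z - w) < e).
  { destruct (Rlt_le_dec z ((bu b + bv b)/2)) as [L|L].
    - exists (z + Rmin (e/2) ((bv b - bu b)/4)).
      destruct (Rmin_cases (e/2) ((bv b - bu b)/4)) as [[? ->]|[? ->]];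
        (split; [lra|apply Rabs_def1; lra]).
    - exists (z - Rmin (e/2) ((bv b - bu b)/4)).
      destruct (Rmin_cases (e/2) ((bv b - bu b)/4)) as [[? ->]|[? ->]];
        (split; [lra|apply Rabs_def1; lra]). }
  destruct W as (w & W1 & W2); exists w; split; [|exact W2].
  split; [split; lra|apply Hne; exact W1].
Qed.

(** The closure restores the fixed points shared by consecutive orbitals, and the interior removes
    the two extreme ends. *)
Lemma ext_supt_chain f x y :
  marked f -> chain x (orbs f) y -> orbs f <> nil ->
  forall t, ext_supt (mf f) t <-> x < t < y.
Proof.
  intros Mf C N t.
  assert (Cl : forall z, closure (supt (mf f)) z -> x <= z <= y).
  { intros z Hz.
    assert (Sx : forall w, supt (mf f) w -> x <= w <= y).
    { intros w Hw; destruct Mf as (_ & _ & _ & H).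
      destruct (H w Hw) as (b & Hb & K); pose proof (chain_in _ _ _ _ C Hb); lra. }
    split; apply Rnot_lt_le; intros L.
    - destruct (Hz (x - z)) as (w & Hw & K); [lra|].
      apply Sx in Hw; apply Rabs_def2 in K; lra.
    - destruct (Hz (z - y)) as (w & Hw & K); [lra|].
      apply Sx in Hw; apply Rabs_def2 in K; lra. }
  split.
  - intros (e & He & H).
    assert (A1 := Cl _ (H (t - e/2) ltac:(apply Rabs_def1; lra))).
    assert (A2 := Cl _ (H (t + e/2) ltac:(apply Rabs_def1; lra))). lra.
  - intros Ht; exists (Rmin (t - x) (y - t)); split.
    + apply Rmin_pos; lra.
    + intros z Hz; eapply (closure_supt_cover f); eauto.
      apply Rabs_def2 in Hz.
      pose proof (Rmin_l (t-x) (y-t)); pose proof (Rmin_r (t-x) (y-t)); lra.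
Qed.

Lemma sorted_chain_or_gap l :
  l <> nil ->
  (forall b, In b l -> bu b < bv b) ->
  (forall l1 b c l2, l = l1 ++ b :: c :: l2 -> bv b <= bu c) ->
  (exists x y, chain x l y) \/
  (exists l1 b c l2, l = l1 ++ b :: c :: l2 /\ bv b < bu c).
Proof.
  induction l as [|b l IH]; intros N H1 H2; [congruence|].
  destruct l as [|c l].
  { left; exists (bu b), (bv b); simpl; repeat split; apply H1; left; reflexivity. }
  destruct IH as [(x & y & C)|(l1 & b' & c' & l2 & E & L)].
  - discriminate.
  - intros d Hd; apply H1; right; exact Hd.
  - intros l1 b' c' l2 E; apply (H2 (b :: l1) b' c' l2); rewrite E; reflexivity.
  - pose proof (H2 nil b c l eq_refl) as [L|L].
    + right; exists nil, b, c, l; auto.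
    + left; exists (bu b), y; split; [reflexivity|].
      split; [apply H1; left; reflexivity|].
      destruct C as (C1 & C2 & C3).
      rewrite L; split; [reflexivity|].
      split; [apply H1; simpl; auto|exact C3].
  - right; exists (b :: l1), b', c', l2; split; [rewrite E; reflexivity|exact L].
Qed.

(** A gap between consecutive orbitals would have its midpoint outside the closure of the support,
    although the orbitals on both sides belong to the extended support. *)
Lemma standard_chain f :
  standard f -> orbs f <> nil /\ exists x y, chain x (orbs f) y.
Proof.
  intros (Mf & (Ne & Int) & _).
  assert (Nn : orbs f <> nil).
  { intros E; destruct Ne as (x & e & He & Hx).
    destruct (Hx x) with (e := 1) as (w & Hw & _); [rewrite Rminus_diag, Rabs_R0; lra|lra|].
    destruct Mf as (_ & _ & _ & H); destruct (H w Hw) as (b & Hb & _).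
    rewrite E in Hb; exact Hb. }
  split; [exact Nn|].
  destruct (sorted_chain_or_gap (orbs f) Nn) as [C|(l1 & b & c & l2 & E & L)].
  - intros b Hb; apply (marked_mbump f b Mf Hb).
  - intros l1 b c l2 E; eapply (marked_split_le f l1 b (c :: l2)); eauto; left; reflexivity.
  - exact C.
  - exfalso.
    assert (Op : forall d, In d (orbs f) -> ext_supt (mf f) ((bu d + bv d)/2)).
    { intros d Hd; destruct (marked_mbump f d Mf Hd) as [(U0 & UV & V1 & Fu & Fv & Hne) _].
      exists ((bv d - bu d)/2); split; [lra|].
      intros z Hz e He; exists z; rewrite Rminus_diag, Rabs_R0; split; [|exact He].
      apply Rabs_def2 in Hz; split; [split; lra|apply Hne; lra]. }
    assert (Ib : In b (orbs f)) by (rewrite E; apply in_elt).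
    assert (Ic : In c (orbs f)) by (rewrite E; apply in_app_iff; simpl; auto).
    pose proof (marked_mbump f b Mf Ib) as [(_ & Ub & _) _].
    pose proof (marked_mbump f c Mf Ic) as [(_ & Uc & _) _].
    pose proof (Int _ ((bv b + bu c)/2) _ (Op b Ib) (Op c Ic) ltac:(lra)) as (e & He & M).
    specialize (M ((bv b + bu c)/2) ltac:(rewrite Rminus_diag, Rabs_R0; exact He)).
    destruct (M ((bu c - bv b)/2)) as (w & Hw & K); [lra|].
    apply Rabs_def2 in K.
    pose proof Mf as (_ & _ & _ & H); destruct (H w Hw) as (d & Hd & Kd).
    rewrite E in Hd; apply in_app_iff in Hd; destruct Hd as [Hd|[<-|Hd]].
    + pose proof (proj1 (marked_split_le f l1 b (c :: l2) d Mf E) Hd); lra.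
    + lra.
    + pose proof (proj2 (marked_split_le f l1 b (c :: l2) d Mf E) Hd).
      destruct Hd as [<-|Hd]; [lra|].
      assert (E' : orbs f = (l1 ++ b :: nil) ++ c :: l2) by (rewrite E, <- app_assoc; reflexivity).
      pose proof (proj2 (marked_split_le f _ c l2 d Mf E') Hd); lra.
Qed.

(** * Rotation of a standard function *)

(** Reduces topology to numbers: the extended support is then the open interval from [x] to [y], and
    [sll] and [ssub] become inequalities between ends. *)
Definition ends (f : MF) (x y : R) : Prop :=
  marked f /\ chain x (orbs f) y /\ orbs f <> nil.

Lemma standard_ends f : standard f -> exists x y, ends f x y.
Proof.
  intros Sf; destruct (standard_chain f Sf) as (N & x & y & C).
  exists x, y; split; [apply Sf|auto].
Qed.

Lemma ends_lt f x y : ends f x y -> x < y.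
Proof. intros (_ & C & N); exact (chain_lt _ _ _ C N). Qed.

Lemma ends_ext f x y : ends f x y -> forall t, ext_supt (mf f) t <-> x < t < y.
Proof. intros (M & C & N); apply ext_supt_chain; auto. Qed.

Lemma ends_in f x y b : ends f x y -> In b (orbs f) -> x <= bu b /\ bu b < bv b /\ bv b <= y.
Proof. intros (_ & C & _); apply chain_in; exact C. Qed.

Lemma ends_foot f x y b t : ends f x y -> In b (orbs f) -> in_foot f b t -> x < t < y.
Proof.
  intros E Hb H; pose proof (ends_in _ _ _ _ E Hb).
  destruct E as (M & _); apply in_foot_inside in H; [lra|apply M|apply marked_mbump; auto].
Qed.

Lemma ends_interval f x y : ends f x y -> is_interval (ext_supt (mf f)).
Proof.
  intros E; pose proof (ends_lt _ _ _ E); split.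
  - exists ((x + y)/2); apply (ends_ext _ _ _ E); lra.
  - intros a b c Ha Hc K; apply (ends_ext _ _ _ E).
    apply (ends_ext _ _ _ E) in Ha; apply (ends_ext _ _ _ E) in Hc; lra.
Qed.

Lemma sll_ends f g x y x' y' : ends f x y -> ends g x' y' -> (sll f g <-> y <= x').
Proof.
  intros E E'; pose proof (ends_lt _ _ _ E); pose proof (ends_lt _ _ _ E'); split.
  - intros H1; apply Rnot_lt_le; intros L.
    set (s := (Rmax x x' + y) / 2); set (t := (x' + Rmin y' s) / 2).
    assert (x < s < y /\ x' < s) as [K1 K2].
    { unfold s, Rmax; destruct (Rle_dec x x'); lra. }
    assert (x' < t < y' /\ t < s) as [K3 K4].
    { unfold t; destruct (Rmin_cases y' s) as [[? ->]|[? ->]]; lra. }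
    specialize (H1 s t); rewrite (ends_ext _ _ _ E), (ends_ext _ _ _ E') in H1.
    specialize (H1 K1 K3); lra.
  - intros L s t Hs Ht; apply (ends_ext _ _ _ E) in Hs; apply (ends_ext _ _ _ E') in Ht; lra.
Qed.

Lemma ssub_ends f g x y x' y' : ends f x y -> ends g x' y' -> (ssub f g <-> x' < x /\ y < y').
Proof.
  intros E E'; pose proof (ends_lt _ _ _ E); split.
  - intros H1.
    assert (A : ext_supt (mf g) x).
    { apply H1; intros e He; exists (x + Rmin (e/2) ((y-x)/2)).
      rewrite (ends_ext _ _ _ E).
      destruct (Rmin_cases (e/2) ((y-x)/2)) as [[? ->]|[? ->]];
        (split; [lra|apply Rabs_def1; lra]). }
    assert (B : ext_supt (mf g) y).
    { apply H1; intros e He; exists (y - Rmin (e/2) ((y-x)/2)).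
      rewrite (ends_ext _ _ _ E).
      destruct (Rmin_cases (e/2) ((y-x)/2)) as [[? ->]|[? ->]];
        (split; [lra|apply Rabs_def1; lra]). }
    apply (ends_ext _ _ _ E') in A; apply (ends_ext _ _ _ E') in B; lra.
  - intros [L1 L2] t Ht; apply (ends_ext _ _ _ E').
    split; apply Rnot_le_lt; intros L.
    + destruct (Ht (x - t)) as (w & Hw & K); [lra|].
      apply (ends_ext _ _ _ E) in Hw; apply Rabs_def2 in K; lra.
    + destruct (Ht (t - y)) as (w & Hw & K); [lra|].
      apply (ends_ext _ _ _ E) in Hw; apply Rabs_def2 in K; lra.
Qed.

Lemma osc_pts f g x y : ends f x y -> osc f g = cnt (fun e => In e (x :: map bv (orbs f))) (orbs g).
Proof.
  intros (M & C & N); unfold osc, cnt, endpoints; f_equal; apply filter_ext; intros c.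
  apply decP_iff; split; intros (e & I & K); exists e; (split; [|exact K]);
    apply (chain_endpoints _ _ _ e C N); exact I.
Qed.

Lemma sll_osc f g : standard f -> standard g -> sll f g -> osc f g = 0%nat.
Proof.
  intros Sf Sg L.
  destruct (standard_ends f Sf) as (x & y & E), (standard_ends g Sg) as (x' & y' & E').
  apply (sll_ends _ _ _ _ _ _ E E') in L.
  rewrite (osc_pts _ _ _ _ E); apply cnt_zero; intros c e Hc He K.
  destruct E as (_ & C & _); apply (chain_pts _ _ _ _ C) in He.
  pose proof (ends_in _ _ _ _ E' Hc); lra.
Qed.

(** Counting over an arbitrary list with a bare map lets the counts be split along the list and
    compared between a function and its rotation. *)
Definition np (f : R -> R) (l : list morb) : nat :=
  length (filter (fun b => decP (pos_on f (bu b) (bv b))) l).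
Definition nn (f : R -> R) (l : list morb) : nat :=
  length (filter (fun b => decP (neg_on f (bu b) (bv b))) l).

Lemma np_cons_pos f b l : pos_on f (bu b) (bv b) -> np f (b :: l) = S (np f l).
Proof. intros H; unfold np; simpl; rewrite decP_true; auto. Qed.
Lemma nn_cons_neg f b l : neg_on f (bu b) (bv b) -> nn f (b :: l) = S (nn f l).
Proof. intros H; unfold nn; simpl; rewrite decP_true; auto. Qed.
Lemma np_cons_neg f b l : bu b < bv b -> neg_on f (bu b) (bv b) -> np f (b :: l) = np f l.
Proof.
  intros L H; unfold np; simpl; rewrite decP_false; auto.
  intros P; exact (not_pos_and_neg _ _ _ L P H).
Qed.
Lemma nn_cons_pos f b l : bu b < bv b -> pos_on f (bu b) (bv b) -> nn f (b :: l) = nn f l.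
Proof.
  intros L H; unfold nn; simpl; rewrite decP_false; auto.
  intros P; exact (not_pos_and_neg _ _ _ L H P).
Qed.
Lemma np_app f l l' : np f (l ++ l') = (np f l + np f l')%nat.
Proof. unfold np; rewrite filter_app, length_app; reflexivity. Qed.
Lemma nn_app f l l' : nn f (l ++ l') = (nn f l + nn f l')%nat.
Proof. unfold nn; rewrite filter_app, length_app; reflexivity. Qed.

Lemma np_nn_agree f g l :
  (forall b t, In b l -> bu b < t < bv b -> f t = g t) -> np f l = np g l /\ nn f l = nn g l.
Proof.
  intros H; unfold np, nn; split; f_equal; apply filter_ext_in; intros b Hb; apply decP_iff;
    split; (apply pos_on_agree || apply neg_on_agree); intros t Ht;
    (eapply H || (symmetry; eapply H)); eauto.
Qed.

Lemma marked_sign f b :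
  marked f -> In b (orbs f) ->
  bu b < bv b /\ (pos_on (mf f) (bu b) (bv b) \/ neg_on (mf f) (bu b) (bv b)).
Proof.
  intros Mf Hb; destruct (marked_mbump f b Mf Hb) as [O _]; split; [apply O|].
  apply homeo_orbital_sign; [apply Mf|exact O].
Qed.

Lemma np_nn_length f l :
  marked f -> incl l (orbs f) -> (np (mf f) l + nn (mf f) l = length l)%nat.
Proof.
  intros Mf; induction l as [|b l IH]; intros I; [reflexivity|].
  assert (IH' := IH (fun c Hc => I c (or_intror Hc))).
  destruct (marked_sign f b Mf (I b (or_introl eq_refl))) as [L [P|P]].
  - rewrite np_cons_pos, nn_cons_pos by auto; simpl; lia.
  - rewrite np_cons_neg, nn_cons_neg by auto; simpl; lia.
Qed.

Lemma np_ex f l : (0 < np f l)%nat -> exists b, In b l /\ pos_on f (bu b) (bv b).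
Proof.
  unfold np; destruct (filter _ l) as [|b l'] eqn:E; simpl; [lia|intros _].
  assert (I : In b (b :: l')) by (left; reflexivity).
  rewrite <- E in I; apply filter_In in I; exists b; split; [apply I|apply decP_elim, I].
Qed.
Lemma nn_ex f l : (0 < nn f l)%nat -> exists b, In b l /\ neg_on f (bu b) (bv b).
Proof.
  unfold nn; destruct (filter _ l) as [|b l'] eqn:E; simpl; [lia|intros _].
  assert (I : In b (b :: l')) by (left; reflexivity).
  rewrite <- E in I; apply filter_In in I; exists b; split; [apply I|apply decP_elim, I].
Qed.

(** With at least two orbitals the balance of signs forces one bump of each sign, and the positive
    ones lie to the right of the negative ones. *)
Lemma standard_outer_signs g b0 m b1 :
  standard g -> orbs g = b0 :: m ++ b1 :: nil ->
  neg_on (mf g) (bu b0) (bv b0) /\ pos_on (mf g) (bu b1) (bv b1).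
Proof.
  intros Sg E; pose proof (standard_ends g Sg) as (x & y & Eg).
  destruct Sg as (Mg & _ & Ord & Cn).
  assert (Len : (np (mf g) (orbs g) + nn (mf g) (orbs g) = length (orbs g))%nat)
    by (apply np_nn_length; [auto|apply incl_refl]).
  change (npos g) with (np (mf g) (orbs g)) in Cn.
  change (nneg g) with (nn (mf g) (orbs g)) in Cn.
  assert (Len' : (2 <= length (orbs g))%nat) by (rewrite E; simpl; rewrite length_app; simpl; lia).
  assert (I0 : In b0 (orbs g)) by (rewrite E; left; reflexivity).
  assert (I1 : In b1 (orbs g)) by (rewrite E; right; apply in_elt).
  destruct (marked_sign g b0 Mg I0) as [L0 S0], (marked_sign g b1 Mg I1) as [L1 S1].
  split.
  - destruct S0 as [P|P]; [exfalso|exact P].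
    destruct (nn_ex (mf g) (orbs g)) as (c & Ic & Nc); [lia|].
    pose proof (Ord b0 c I0 Ic P Nc).
    destruct Eg as (_ & C & _); rewrite E in C, Ic; destruct C as (C1 & C2 & C3), Ic as [<-|Ic].
    + exact (not_pos_and_neg _ _ _ L0 P Nc).
    + pose proof (chain_in _ _ _ _ C3 Ic); lra.
  - destruct S1 as [P|P]; [exact P|exfalso].
    destruct (np_ex (mf g) (orbs g)) as (c & Ic & Nc); [lia|].
    pose proof (Ord c b1 Ic I1 Nc P).
    pose proof (ends_in _ _ _ _ Eg Ic).
    destruct Eg as (_ & C & _); rewrite E, app_comm_cons in C.
    apply chain_app in C; destruct C as (z & _ & C); simpl in C.
    lra.
Qed.

(** In the short case the positive bump is the last orbital, since with two orbitals the first is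
    negative. Both cases thus describe the rotation by the position of bumps in the list. *)
Lemma circ_shape g h :
  standard g -> circ g h ->
  (exists b0 m b1, orbs g = b0 :: m ++ b1 :: nil /\ m <> nil /\ orbs h = m /\
     (forall b t, In b m -> bu b < t < bv b -> mf h t = mf g t)) \/
  (exists p b mk, orbs g = p ++ b :: nil /\ (length p <= 1)%nat /\
     orbs h = MOrb (bu b) (bs b) mk :: nil /\ pos_on (mf h) (bu b) (bs b)).
Proof.
  intros Sg (Mh & [(Len & Eh & H)|(Len & b & mk & Hb & Pb & Eh & Ph)]).
  - left; destruct (orbs g) as [|b0 l] eqn:Eg; [simpl in Len; lia|].
    destruct (exists_last (l := l)) as (m & b1 & ->); [intros ->; simpl in Len; lia|].
    exists b0, m, b1; simpl in Eh; rewrite removelast_last in Eh; subst m.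
    split; [reflexivity|]; split; [|split; [reflexivity|]].
    + intros K; rewrite K in Len; simpl in Len; lia.
    + intros b t Hb Ht.
      destruct (marked_mbump h b Mh Hb) as [(U0 & UV & V1 & _) _].
      apply (H t); [split; lra|exists b; auto].
  - right; destruct (exists_last (l := orbs g)) as (p & b' & E).
    { intros E; rewrite E in Hb; exact Hb. }
    assert (Hl : (length p <= 1)%nat) by (rewrite E, length_app in Len; simpl in Len; lia).
    exists p, b, mk; split; [|split; [exact Hl|auto]].
    rewrite E; f_equal; f_equal.
    rewrite E in Hb; apply in_app_iff in Hb; destruct Hb as [Hb|[Hb|[]]]; [|exact Hb].
    exfalso; destruct p as [|b0 [|? ?]]; simpl in Hb, Hl; try tauto; try lia.
    destruct Hb as [->|[]].
    pose proof (standard_outer_signs g b nil b' Sg E) as [K _].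
    eapply not_pos_and_neg; [|exact Pb|exact K].
    apply (marked_sign g); [apply Sg|rewrite E; left; reflexivity].
Qed.

(** The two extreme bumps have opposite signs, so removing them keeps the difference of the counts;
    in the short case a single positive bump remains. *)
Lemma standard_circ g h : standard g -> circ g h -> standard h.
Proof.
  intros Sg Hc; pose proof Hc as (Mh & _).
  destruct (standard_ends g Sg) as (x & y & Mg & C & Ng).
  destruct (circ_shape g h Sg Hc) as [(b0 & m & b1 & E & Nm & Eh & Ag)|(p & b & mk & E & Hl & Eh & Ph)].
  - destruct (standard_outer_signs g b0 m b1 Sg E) as [S0 S1].
    rewrite E in C; destruct C as (C0 & C1 & C2).
    apply chain_app in C2; destruct C2 as (z & C2 & C3).
    assert (Im : incl m (orbs g)).
    { intros c Ic; rewrite E; right; apply in_app_iff; auto. }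
    destruct Sg as (_ & _ & Ord & Cn).
    split; [exact Mh|split; [|split]].
    + apply (ends_interval h (bv b0) z); split; [exact Mh|]; rewrite Eh; auto.
    + rewrite Eh; intros b c Ib Ic P N; apply Ord; auto.
      * eapply pos_on_agree; [|exact P]; eauto.
      * eapply neg_on_agree; [|exact N]; eauto.
    + change (npos h) with (np (mf h) (orbs h)).
      change (nneg h) with (nn (mf h) (orbs h)).
      change (npos g) with (np (mf g) (orbs g)) in Cn.
      change (nneg g) with (nn (mf g) (orbs g)) in Cn.
      destruct (np_nn_agree (mf h) (mf g) m Ag) as [K1 K2].
      rewrite Eh, K1, K2; rewrite E in Cn.
      assert (bu b1 < bv b1) by (simpl in C3; lra).
      rewrite np_cons_neg, nn_cons_neg, np_app, nn_app in Cn by (auto; lra).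
      rewrite (np_cons_pos _ b1), (nn_cons_pos _ b1) in Cn by auto.
      change (np (mf g) nil) with 0%nat in Cn; change (nn (mf g) nil) with 0%nat in Cn; lia.
  - assert (Hb : mbump h (MOrb (bu b) (bs b) mk)).
    { apply marked_mbump; [exact Mh|rewrite Eh; left; reflexivity]. }
    assert (L : bu b < bs b) by (destruct Hb as [(_ & L & _) _]; exact L).
    split; [exact Mh|split; [|split]].
    + apply (ends_interval h (bu b) (bs b)); split; [exact Mh|]; rewrite Eh; simpl; split; [auto|discriminate].
    + rewrite Eh; intros c d [<-|[]] [<-|[]] P N; exfalso; simpl in P, N.
      exact (not_pos_and_neg _ _ _ L P N).
    + right; change (npos h) with (np (mf h) (orbs h)).
      change (nneg h) with (nn (mf h) (orbs h)); rewrite Eh.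
      rewrite np_cons_pos, nn_cons_pos by auto; reflexivity.
Qed.

Lemma noclash_start_ne f g x y b c :
  ends f x y -> marked g -> noclash f g -> In c (orbs g) -> bu b = bu c -> In b (orbs f) -> False.
Proof.
  intros E Mg H Hc Q Hb; destruct E as (Mf & _).
  pose proof (noclash_left f g b c Mf Mg H Hb Hc ltac:(lra)).
  destruct (marked_mbump g c Mg Hc) as [_ K]; lra.
Qed.

Lemma osc_circ f g h :
  standard f -> standard g -> noclash f g -> ssub f g -> circ g h -> slt h f ->
  osc f g = S (osc h f).
Proof.
  intros Sf Sg Nc Sub Hc Lt.
  pose proof (standard_circ g h Sg Hc) as Sh.
  destruct (standard_ends f Sf) as (f0 & fM & Ef), (standard_ends g Sg) as (g0 & gN & Eg).
  destruct (standard_ends h Sh) as (h0 & h1 & Eh).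
  apply (ssub_ends _ _ _ _ _ _ Ef Eg) in Sub; destruct Sub as [Sub0 Sub1].
  pose proof (ends_lt _ _ _ Ef) as Lf.
  assert (Pf : forall e, In e (f0 :: map bv (orbs f)) ->
             f0 <= e <= fM /\ (e = fM \/ exists b, In b (orbs f) /\ bu b = e)).
  { intros e He; destruct Ef as (_ & C & _); exact (chain_pts _ _ _ _ C He). }
  (* What both shapes of the rotation share: the last orbital [b] of g starts no later than h ends.
     If it is the only orbital, h starts where g does and so cannot be nested in f. *)
  assert (Lst : exists p b, orbs g = p ++ b :: nil /\ bu b <= h1 /\ h0 < h1 /\
            (length p <> 0%nat -> h0 <= bu b) /\ (length p = 0%nat -> h0 = g0)).
  { destruct (circ_shape g h Sg Hc) as [(b0 & m & b1 & E & Nm & Eqh & _)|(p & b & mk & E & Hl & Eqh & _)].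
    - exists (b0 :: m), b1; split; [rewrite E; reflexivity|].
      destruct Eg as (_ & Cg & _); rewrite E in Cg; destruct Cg as (C0 & C1 & C2).
      apply chain_app in C2; destruct C2 as (z & C2 & C3).
      destruct Eh as (_ & Ch & _); rewrite Eqh in Ch.
      assert (h0 = bv b0).
      { destruct m as [|b m]; [congruence|]. destruct Ch as (Q & _), C2 as (Q' & _); lra. }
      subst h0.
      assert (z = h1).
      { clear - C2 Ch. revert C2 Ch; generalize (bv b0); induction m as [|b m IH]; simpl; intros r A B.
        - lra.
        - apply (IH (bv b)); tauto. }
      subst z; simpl in C3; destruct C3 as (Q & C3 & C4); apply (chain_lt _ _ _) in C2; [|exact Nm].
      repeat split; try lra. simpl; lia.
    - exists p, b; split; [exact E|].
      destruct Eh as (Mh & Ch & _); rewrite Eqh in Ch; simpl in Ch.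
      repeat split; try lra.
      intros Q; destruct p; [|discriminate]. destruct Eg as (_ & Cg & _); rewrite E in Cg.
      simpl in Cg; lra. }
  destruct Lt as [Lt|Lt].
  (* To the right of h, the whole of f lies in the last orbital of g, so the oscillations are 1 and
     0. *)
  - apply (sll_ends _ _ _ _ _ _ Eh Ef) in Lt.
    destruct Lst as (p & b & E & L1 & L2 & _).
    rewrite (osc_pts _ _ _ _ Ef), (osc_pts _ _ _ _ Eh).
    rewrite (cnt_zero (fun e => In e (h0 :: _))).
    + destruct Eg as (_ & Cg & _); rewrite E in Cg |- *.
      rewrite cnt_app; apply chain_app in Cg; destruct Cg as (z & C1 & C2); simpl in C2.
      rewrite (cnt_hit _ b nil fM).
      * rewrite (cnt_zero _ p); [reflexivity|].
        intros c e Ic He K; apply Pf in He; pose proof (chain_in _ _ _ _ C1 Ic); lra.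
      * destruct Ef as (_ & Cf & _); exact (chain_end_pt _ _ _ Cf).
      * lra.
    + intros c e Ic He K; destruct Eh as (_ & Ch & _); apply (chain_pts _ _ _ _ Ch) in He.
      pose proof (ends_in _ _ _ _ Ef Ic); lra.
  - apply (ssub_ends _ _ _ _ _ _ Eh Ef) in Lt; destruct Lt as [Lt0 Lt1].
    destruct Lst as (p & b & E & L1 & L2 & L3 & L4).
    destruct p as [|c p]; [specialize (L4 eq_refl); lra|].
    clear L4; specialize (L3 ltac:(discriminate)).
    simpl in E.
    pose proof Eg as (Mg & Cg & _).
    pose proof Ef as (Mf & Cf & _).
    pose proof Eh as (Mh & Ch & _).
    rewrite (osc_pts _ _ _ _ Ef), E.
    rewrite E in Cg; pose proof Cg as (C0 & C1 & C2).
    pose proof C2 as C3; apply chain_app in C3; destruct C3 as (z & C3 & C4); simpl in C4.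
    (* Since f surrounds h, it starts in the first orbital of g and ends in the last; these are the
       hypotheses on the ends of the two chains. *)
    rewrite (cnt_interleave _ (orbs f) c g0 gN f0 fM Cg Cf); auto.
    + f_equal.
      destruct (circ_shape g h Sg Hc) as [(b0 & m & b1 & E' & Nm & Eqh & _)|(p' & b' & mk & E' & Hl & Eqh & _)].
      * assert (A : c = b0 /\ p ++ b :: nil = m ++ b1 :: nil) by (rewrite E in E'; injection E'; auto).
        destruct A as [-> A]; rewrite A.
        apply cnt_ext; intros d _.
        rewrite A in C2; rewrite <- Eqh in *.
        split; intros (e & I & K); exists e; (split; [|exact K]);
          apply (chain_inner _ _ _ _ e C2 Nm); exact I.
      * assert (A : b' = b /\ p = nil).
        { rewrite E in E'; rewrite app_comm_cons in E'. apply app_inj_tail in E'.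
          destruct E' as [<- ->]; split; [reflexivity|]. destruct p; [reflexivity|simpl in Hl; lia]. }
        destruct A as [-> ->]; unfold osc, endpoints; rewrite Eqh; simpl.
        assert (Ib : In b (orbs g)) by (rewrite E; simpl; auto).
        apply cnt_ext; intros d Id; split.
        -- intros (e & I & K); exists e; simpl in I |- *; tauto.
        -- rewrite Eqh in Ch; simpl in Ch.
           (* The right end of h is the marker of [b]. A cell of f containing it cannot start in the
              left foot of [b] or at its left end, so it starts earlier and contains [bu b] as
              well. *)
           intros (e & [<-|[<-|[]]] & K); exists (bu b); (split; [left; reflexivity|]); [exact K|].
           destruct (Rlt_le_dec (bu d) (bu b)) as [M|M]; [lra|].
           pose proof (noclash_left f g d b Mf Mg Nc Id Ib M); lra.
    + split; [exact Sub0|].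
      destruct (circ_shape g h Sg Hc) as [(b0 & m & b1 & E' & Nm & Eqh & _)|(p' & b' & mk & E' & Hl & Eqh & _)].
      * assert (c = b0) as -> by (rewrite E in E'; injection E'; auto).
        assert (A : p ++ b :: nil = m ++ b1 :: nil) by (rewrite E in E'; injection E'; auto).
        rewrite A in C2; rewrite Eqh in Ch; destruct m as [|d m]; [congruence|].
        destruct C2 as (Q & _), Ch as (Q' & _); lra.
      * rewrite E in E'; rewrite app_comm_cons in E'. apply app_inj_tail in E'.
        destruct E' as [<- <-]; destruct p; [|simpl in Hl; lia].
        rewrite Eqh in Ch; simpl in Ch, C3; lra.
    + intros d Id; apply in_app_iff in Id; destruct Id as [Id|[<-|[]]].
      * pose proof (chain_in _ _ _ _ C3 Id); lra.
      * lra.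
    + intros d e Id He Q; apply Pf in He; destruct He as [_ [->|(b' & Ib' & Q')]].
      * assert (bu d <= bu b).
        { apply in_app_iff in Id; destruct Id as [Id|[<-|[]]]; [|lra].
          pose proof (chain_in _ _ _ _ C3 Id); lra. }
        lra.
      * apply (noclash_start_ne f g f0 fM b' d Ef Mg Nc); auto; [|congruence].
        rewrite E; right; exact Id.
Qed.

(** * Signatures: condition (!) and rotation *)

(** Inner bumps keep their feet, and the new bump of the short case is supported in one left foot of
    g. Hence rotation preserves disjointness of feet. *)
Lemma circ_feet g h d t :
  standard g -> circ g h -> In d (orbs h) -> in_foot h d t ->
  exists b, In b (orbs g) /\ in_foot g b t.
Proof.
  intros Sg Hc Id H; pose proof Hc as (Mh & _).
  pose proof (marked_mbump h d Mh Id) as Md.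
  destruct (circ_shape g h Sg Hc) as [(b0 & m & b1 & E & Nm & Eh & Ag)|(p & b & mk & E & _ & Eh & _)].
  - exists d; rewrite Eh in Id; split.
    + rewrite E; right; apply in_app_iff; auto.
    + refine (in_foot_agree h g d t (proj1 Mh) Md _ H); intros s Hs; apply (Ag d); auto.
  - exists b; split; [rewrite E; apply in_elt|].
    apply in_foot_inside in H; [|apply Mh|exact Md].
    rewrite Eh in Id; destruct Id as [<-|[]]; left; exact H.
Qed.

Lemma noclash_sym f g : noclash f g -> noclash g f.
Proof. intros H b c Hb Hc t [T1 T2]; apply (H c b Hc Hb t); auto. Qed.

Lemma noclash_circ f g h : standard g -> circ g h -> noclash f g -> noclash f h.
Proof.
  intros Sg Hc N b d Hb Hd t [T1 T2].
  destruct (circ_feet g h d t Sg Hc Hd T2) as (c & Ic & K).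
  apply (N b c Hb Ic t); auto.
Qed.

(** [circ] determines the supports of all bumps; freedom remains only in the marker and the values
    of the new bump of the short case. *)
Lemma circ_same_ends g h1 h2 x y :
  standard g -> circ g h1 -> circ g h2 -> ends h1 x y -> ends h2 x y.
Proof.
  intros Sg H1 H2 (M1 & C & N); pose proof H2 as (M2 & _); split; [exact M2|].
  destruct (circ_shape g h1 Sg H1) as [(b0 & m & b1 & E & Nm & Eh & _)|(p & b & mk & E & Lp & Eh & _)];
  destruct (circ_shape g h2 Sg H2) as [(b0' & m' & b1' & E' & Nm' & Eh' & _)|(p' & b' & mk' & E' & Lp' & Eh' & _)];
    rewrite E in E'.
  - rewrite 2 app_comm_cons in E'; apply app_inj_tail in E'; destruct E' as [E' _].
    injection E' as _ E'; rewrite Eh', <- E', <- Eh; auto.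
  - exfalso; apply (f_equal (@length _)) in E'; simpl in E'; rewrite !length_app in E'.
    destruct m; [congruence|]; simpl in E'; lia.
  - exfalso; apply (f_equal (@length _)) in E'; simpl in E'; rewrite !length_app in E'.
    destruct m'; [congruence|]; simpl in E'; lia.
  - apply app_inj_tail in E'; destruct E' as [_ <-].
    rewrite Eh in C; rewrite Eh'; split; [exact C|discriminate].
Qed.

Lemma circ_same_slt g h1 h2 f :
  standard g -> standard f -> circ g h1 -> circ g h2 ->
  (sll h1 f -> sll h2 f) /\ (ssub h1 f -> ssub h2 f) /\
  (sll f h1 -> sll f h2) /\ (ssub f h1 -> ssub f h2).
Proof.
  intros Sg Sf H1 H2.
  destruct (standard_ends h1 (standard_circ g h1 Sg H1)) as (x & y & E1).
  pose proof (circ_same_ends g h1 h2 x y Sg H1 H2 E1) as E2.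
  destruct (standard_ends f Sf) as (x' & y' & E).
  rewrite (sll_ends _ _ _ _ _ _ E1 E), (sll_ends _ _ _ _ _ _ E2 E).
  rewrite (ssub_ends _ _ _ _ _ _ E1 E), (ssub_ends _ _ _ _ _ _ E2 E).
  rewrite (sll_ends _ _ _ _ _ _ E E1), (sll_ends _ _ _ _ _ _ E E2).
  rewrite (ssub_ends _ _ _ _ _ _ E E1), (ssub_ends _ _ _ _ _ _ E E2). tauto.
Qed.

(* Only the marker of the rotation of c is undetermined, and only when c has at
   most two bumps; nothing further can then be nested inside that rotation. *)
Lemma std_pair_circ_choice b c h1 h2 :
  standard b -> standard c -> noclash b c ->
  circ c h1 -> circ c h2 -> std_pair h2 b -> std_pair h1 b.
Proof.
  intros Sb Sc Nc H1 H2 P.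
  pose proof (standard_circ c h1 Sc H1) as S1; pose proof (standard_circ c h2 Sc H2) as S2.
  destruct (circ_same_slt c h2 h1 b Sc Sb H2 H1) as (K1 & K2 & _).
  assert (F : fast (h1 :: b :: nil)).
  { apply fast_pair; [apply S1|apply Sb|].
    apply noclash_sym, (noclash_circ b c); auto. }
  inversion P as [? ? _ L|? ? k _ L Ck Pk]; subst; [apply sp_ll; auto|].
  apply (sp_sub h1 b k F (K2 L) Ck).
  pose proof (standard_circ b k Sb Ck) as Sk.
  assert (Nk : noclash k h1).
  { apply noclash_sym, (noclash_circ h1 b k Sb Ck).
    apply fast_pair in F; [exact F|apply S1|apply Sb]. }
  assert (Fk : fast (k :: h1 :: nil)) by (apply fast_pair; [apply Sk|apply S1|exact Nk]).
  destruct (circ_same_slt c h2 h1 k Sc Sk H2 H1) as (_ & _ & K3 & K4).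
  inversion Pk as [? ? _ L'|? ? j _ L' Cj Pj]; subst; [apply sp_ll; auto|].
  apply (sp_sub k h1 j Fk (K4 L')); [|exact Pj].
  destruct (circ_shape c h1 Sc H1) as [(b0 & m & b1 & E & Nm & Eh & Ag)|(p & d & mk & E & Lp & Eh & _)].
  - destruct (circ_shape c h2 Sc H2) as [(b0' & m' & b1' & E' & Nm' & Eh' & Ag')|(p' & d' & mk' & E' & Lp' & Eh' & _)].
    2:{ exfalso; rewrite E in E'; apply (f_equal (@length _)) in E'; simpl in E'.
        rewrite !length_app in E'; destruct m; [congruence|]; simpl in E'; lia. }
    rewrite E in E'; rewrite 2 app_comm_cons in E'; apply app_inj_tail in E'; destruct E' as [E' _].
    injection E' as _ E'; subst m'; rewrite <- Eh' in Ag, Ag', Eh; clear Eh'.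
    (* In the long case [h1] and [h2] have the same marked orbitals and agree on them, so a rotation
       of one is a rotation of the other. *)
    assert (Ag2 : forall b0 t, In b0 (orbs h2) -> bu b0 < t < bv b0 -> mf h2 t = mf h1 t).
    { intros e t I K; rewrite (Ag' e), (Ag e); auto. }
    destruct Cj as (Mj & Cj); split; [exact Mj|]; rewrite Eh.
    destruct Cj as [(Len & Ej & Aj)|(Len & e & me & Ie & Pe & Ej & Pe')].
    + left; split; [exact Len|split; [exact Ej|]].
      intros t It; split; intros Q; [|apply (Aj t It); exact Q].
      rewrite (proj1 (Aj t It) Q); destruct Q as (e & Ie & Ke); apply (Ag2 e); [|exact Ke].
      rewrite Ej in Ie; destruct (orbs h2) as [|e0 l]; [contradiction|].
      right; simpl in Ie; clear -Ie. revert Ie; induction l as [|e1 l IH]; [tauto|].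
      destruct l as [|e2 l]; [simpl; tauto|].
      intros [<-|I]; [left; reflexivity|right; apply IH; exact I].
    + right; split; [exact Len|]; exists e, me; split; [exact Ie|split; [|auto]].
      apply (pos_on_agree (mf h2)); [|exact Pe]; intros t Ht; apply (Ag2 e); auto.
  - exfalso. (* k would have to start inside the left foot of d *)
    destruct (standard_ends k Sk) as (k0 & k1 & Ek), (standard_ends h1 S1) as (x & y & E1).
    apply K4, (ssub_ends _ _ _ _ _ _ Ek E1) in L'.
    destruct E1 as (_ & C1 & _); rewrite Eh in C1; simpl in C1.
    pose proof (ends_lt _ _ _ Ek).
    destruct Ek as (Mk & Ck' & Nk').
    destruct (orbs k) as [|e l] eqn:Ok; [congruence|]; destruct Ck' as (Q & _).
    assert (Nkc : noclash k c).
    { apply noclash_sym, (noclash_circ c b k Sb Ck), noclash_sym, Nc. }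
    assert (bs d <= bu e).
    { apply (noclash_left k c e d Mk); auto.
      - apply Sc.
      - rewrite Ok; left; reflexivity.
      - rewrite E; apply in_elt.
      - lra. }
    lra.
Qed.

Lemma std_pair_noclash f g : standard f -> standard g -> std_pair f g -> noclash f g.
Proof.
  intros Sf Sg P; apply fast_pair; [apply Sf|apply Sg|]; inversion P; auto.
Qed.

Lemma std_pair_slt f g : std_pair f g -> slt f g.
Proof. intros P; inversion P; [left|right]; auto. Qed.

Lemma sll_not_ssub f g : standard f -> standard g -> sll f g -> ssub f g -> False.
Proof.
  intros Sf Sg L S.
  destruct (standard_ends f Sf) as (x & y & E), (standard_ends g Sg) as (x' & y' & E').
  apply (sll_ends _ _ _ _ _ _ E E') in L; apply (ssub_ends _ _ _ _ _ _ E E') in S.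
  pose proof (ends_lt _ _ _ E); lra.
Qed.

Lemma slt_sll_trans f g k :
  standard f -> standard g -> standard k -> slt f g -> sll g k -> sll f k.
Proof.
  intros Sf Sg Sk L S.
  destruct (standard_ends f Sf) as (x & y & E), (standard_ends g Sg) as (x' & y' & E'),
    (standard_ends k Sk) as (x'' & y'' & E'').
  apply (sll_ends _ _ _ _ _ _ E E''); apply (sll_ends _ _ _ _ _ _ E' E'') in S.
  pose proof (ends_lt _ _ _ E'); pose proof (ends_lt _ _ _ E).
  destruct L as [L|L];
    [apply (sll_ends _ _ _ _ _ _ E E') in L|apply (ssub_ends _ _ _ _ _ _ E E') in L]; lra.
Qed.

Lemma slt_sll_ssub f g k :
  standard f -> standard g -> standard k -> slt f g -> sll f k -> ssub g k -> sll f g.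
Proof.
  intros Sf Sg Sk L S S'.
  destruct (standard_ends f Sf) as (x & y & E), (standard_ends g Sg) as (x' & y' & E'),
    (standard_ends k Sk) as (x'' & y'' & E'').
  pose proof (ends_lt _ _ _ E); pose proof (ends_lt _ _ _ E').
  apply (sll_ends _ _ _ _ _ _ E E').
  apply (sll_ends _ _ _ _ _ _ E E'') in S; apply (ssub_ends _ _ _ _ _ _ E' E'') in S'.
  destruct L as [L|L];
    [apply (sll_ends _ _ _ _ _ _ E E') in L|apply (ssub_ends _ _ _ _ _ _ E E') in L]; lra.
Qed.

(* Rotating c to the bottom of the triple replaces (r, p, q) by (q - 1, r, p - 1),
   and this preserves [bang_rel r p q] in both directions. *)
Lemma triple_bang n : forall a b c,
  (osc a b + osc b c + osc a c <= n)%nat ->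
  standard a -> standard b -> standard c ->
  std_pair a b -> std_pair b c -> std_pair a c ->
  bang_rel (Z.of_nat (osc a b)) (Z.of_nat (osc b c)) (Z.of_nat (osc a c)).
Proof.
  induction n as [n IH] using lt_wf_ind; intros a b c Hn Sa Sb Sc Pab Pbc Pac.
  pose proof (std_pair_noclash a c Sa Sc Pac) as Nac.
  pose proof (std_pair_noclash b c Sb Sc Pbc) as Nbc.
  inversion Pbc as [? ? _ L|? ? h2 _ Lbc C2 P2]; subst.
  (* Here p = q = 0, and the relation only asks that r be at least -1. *)
  { pose proof (slt_sll_trans a b c Sa Sb Sc (std_pair_slt _ _ Pab) L) as L'.
    rewrite (sll_osc b c), (sll_osc a c) by auto; unfold bang_rel; lia. }
  inversion Pac as [? ? _ L|? ? h1 _ Lac C1 P1]; subst.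
  (* Now a is left of c while b is nested in c, hence a is left of b and r = q = 0. *)
  { rewrite (sll_osc a c), (sll_osc a b) by (auto; eapply slt_sll_ssub; eauto using std_pair_slt).
    unfold bang_rel; lia. }
  (* The derivations for (a, c) and (b, c) supply their own rotations of c; the second is
     transferred to [h1]. *)
  apply (std_pair_circ_choice b c h1 h2 Sb Sc Nbc C1 C2) in P2.
  pose proof (standard_circ c h1 Sc C1) as S1.
  pose proof (osc_circ a c h1 Sa Sc Nac Lac C1 (std_pair_slt _ _ P1)) as Oa.
  pose proof (osc_circ b c h1 Sb Sc Nbc Lbc C1 (std_pair_slt _ _ P2)) as Ob.
  pose proof (IH (osc h1 a + osc a b + osc h1 b)%nat ltac:(lia) h1 a b (le_n _)
    S1 Sa Sb P1 Pab P2) as K.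
  unfold bang_rel in *; lia.
Qed.

Lemma in_S_bang A :
  in_S A -> bang (length A) (sig A).
Proof.
  intros [HS HP] i j k [L1 L2] L3; unfold sig.
  eapply triple_bang; [apply le_n|..]; try (apply HS, nth_In; lia); apply HP; lia.
Qed.

Lemma sig_bang n F A :
  in_S A -> length A = n -> (forall i j, (i < j < n)%nat -> F i j = sig A i j) -> bang n F.
Proof.
  intros HA <- E i j k [L1 L2] L3; rewrite !E by lia.
  apply in_S_bang; auto.
Qed.

(** * Rotating the greatest element of a set in the class *)

Section Rotation.
Variables (A : list MF) (c : MF).
Hypothesis HA : in_S (A ++ c :: nil).
Let a i := nth i A mf_default.
Let full := A ++ c :: nil.

Lemma nth_full_l i : (i < length A)%nat -> nth i full mf_default = a i.
Proof. intros L; apply app_nth1; exact L. Qed.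

Lemma nth_full_r : nth (length A) full mf_default = c.
Proof. apply nth_middle. Qed.

Lemma std_a i : (i < length A)%nat -> standard (a i).
Proof. intros L; apply HA, in_app_iff; left; apply nth_In; exact L. Qed.

Lemma std_c : standard c.
Proof. apply HA, in_elt. Qed.

Lemma pair_a i j : (i < j < length A)%nat -> slt (a i) (a j) /\ std_pair (a i) (a j).
Proof.
  intros L; rewrite <- (nth_full_l i), <- (nth_full_l j) by lia.
  apply HA; rewrite length_app; simpl; lia.
Qed.

Lemma pair_c i : (i < length A)%nat -> std_pair (a i) c.
Proof.
  intros L; rewrite <- (nth_full_l i), <- nth_full_r by lia.
  apply HA; rewrite length_app; simpl; lia.
Qed.

Lemma ssub_of_osc i : (i < length A)%nat -> (0 < osc (a i) c)%nat -> ssub (a i) c.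
Proof.
  intros L H; pose proof (pair_c i L) as P; inversion P as [? ? _ K|]; subst; auto.
  rewrite sll_osc in H; auto using std_a, std_c; lia.
Qed.

(** By the oscillation identity a nested pair has positive oscillation, so the value 0 detects
    [sll]. *)
Lemma sll_of_osc i : (i < length A)%nat -> osc (a i) c = 0%nat -> sll (a i) c.
Proof.
  intros L H; pose proof (pair_c i L) as P; inversion P as [|? ? h _ K C Q]; subst; auto.
  rewrite (osc_circ (a i) c h) in H; auto using std_a, std_c, std_pair_noclash, std_pair_slt.
  discriminate.
Qed.

(** Whatever is below an element left of [c] is itself left of [c], so the zeros against [c] form an
    initial segment. *)
Lemma osc_threshold_le d :
  (d <= length A)%nat -> exists k, (k <= d)%nat /\
    (forall i, (i < k)%nat -> osc (a i) c = 0%nat) /\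
    (forall i, (k <= i < d)%nat -> (0 < osc (a i) c)%nat).
Proof.
  induction d as [|d IH]; intros L.
  { exists 0%nat; repeat split; intros; lia. }
  destruct IH as (k & K1 & K2 & K3); [lia|].
  destruct (Nat.eq_dec (osc (a d) c) 0) as [Z|Z].
  - exists (S d); split; [lia|split; [|intros; lia]].
    intros i Li; destruct (Nat.eq_dec i d) as [->|]; [exact Z|].
    apply sll_osc; auto using std_c; [apply std_a; lia|].
    apply (slt_sll_trans (a i) (a d) c); auto using std_c; try (apply std_a; lia).
    + apply pair_a; lia.
    + apply sll_of_osc; [lia|exact Z].
  - exists k; split; [lia|split; [exact K2|]].
    intros i Li; destruct (Nat.eq_dec i d) as [->|]; [lia|apply K3; lia].
Qed.

Lemma sll_below k i j :
  (forall i, (i < k)%nat -> osc (a i) c = 0%nat) ->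
  (forall i, (k <= i < length A)%nat -> (0 < osc (a i) c)%nat) ->
  (i < k <= j)%nat -> (j < length A)%nat -> sll (a i) (a j).
Proof.
  intros K1 K2 L1 L2; apply (slt_sll_ssub (a i) (a j) c); auto using std_c.
  - apply std_a; lia.
  - apply std_a; lia.
  - apply pair_a; lia.
  - apply sll_of_osc; [lia|apply K1; lia].
  - apply ssub_of_osc; [lia|apply K2; lia].
Qed.

Lemma split_at_threshold k i j :
  (forall i, (i < k)%nat -> osc (a i) c = 0%nat) ->
  (forall i, (k <= i < length A)%nat -> (0 < osc (a i) c)%nat) ->
  (k <= length A)%nat -> (i < k)%nat -> (k <= j < S (length A))%nat -> sig full i j = 0%nat.
Proof.
  intros K1 K2 Lk L1 L2; unfold sig; rewrite nth_full_l by lia.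
  destruct (Nat.eq_dec j (length A)) as [->|N].
  - rewrite nth_full_r; apply K1; lia.
  - rewrite nth_full_l by lia; apply sll_osc; try (apply std_a; lia).
    apply (sll_below k); auto; lia.
Qed.

Lemma rotation_zero :
  (forall i, (i < length A)%nat -> osc (a i) c = 0%nat) ->
  rotrel (length full) (sig full) (length A) (sigZ A).
Proof.
  intros Z; assert (Lf : length full = S (length A)) by (unfold full; rewrite length_app; simpl; lia).
  destruct (Nat.eq_dec (length A) 0) as [E|E].
  { rewrite E; apply rot_small; lia. }
  (* The signature is a sum whose second summand is the singleton of [c], with empty rotation: hence
     the 0. *)
  replace (length A) with (length A + 0)%nat at 1 by lia.
  apply (rot_dec _ _ (length A) 0 (fun _ _ => 0%Z)).
  - split; [lia|]; intros i j L1 L2; apply (split_at_threshold (length A)); auto; try lia.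
  - apply rot_small; lia.
  - intros i j L1 L2; unfold sigZ, sig; rewrite !nth_full_l by lia; reflexivity.
  - intros i j L1 L2; lia.
  - intros i j L1 L2; lia.
Qed.

(** The rotated element belongs right after the [k] elements left of [c]: it is above these and
    below those nested in [c]. From [k] on all values against [c] are positive, so this part is
    indecomposable and is the one that [rotrel] rotates. *)
Lemma rotation_pos h :
  circ c h -> (exists i, (i < length A)%nat /\ (0 < osc (a i) c)%nat) ->
  exists L : list MF, Permutation L (A ++ h :: nil) /\
    (forall i j, (i < j < length L)%nat ->
       slt (nth i L mf_default) (nth j L mf_default)) /\
    rotrel (length full) (sig full) (length L) (sigZ L).
Proof.
  intros Hc (i0 & Li0 & Pi0).
  destruct (osc_threshold_le (length A) (le_n _)) as (k & Lk & K1 & K2).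
  assert (Lk' : (k < length A)%nat).
  { destruct (Nat.eq_dec k (length A)) as [->|]; [|lia].
    rewrite K1 in Pi0 by lia; lia. }
  pose proof std_c as Sc.
  pose proof (standard_circ c h Sc Hc) as Sh.
  assert (Lf : length full = S (length A)) by (unfold full; rewrite length_app; simpl; lia).
  set (L := firstn k A ++ h :: skipn k A).
  assert (LL : length L = S (length A)).
  { unfold L; rewrite length_app; simpl; rewrite length_firstn, length_skipn; lia. }
  assert (N1 : forall i, (i < k)%nat -> nth i L mf_default = a i).
  { intros i H; unfold L, a; rewrite app_nth1 by (rewrite length_firstn; lia).
    rewrite <- (firstn_skipn k A) at 2; rewrite app_nth1 by (rewrite length_firstn; lia).
    reflexivity. }
  assert (N2 : nth k L mf_default = h).
  { unfold L; rewrite app_nth2 by (rewrite length_firstn; lia).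
    rewrite length_firstn, Nat.min_l, Nat.sub_diag by lia; reflexivity. }
  assert (N3 : forall i, (k <= i)%nat -> nth (S i) L mf_default = a i).
  { intros i H; unfold L, a; rewrite app_nth2 by (rewrite length_firstn; lia).
    rewrite length_firstn, Nat.min_l by lia.
    replace (S i - k)%nat with (S (i - k)) by lia; simpl.
    rewrite nth_skipn; f_equal; lia. }
  (* The extended support of [h] stays within that of [c]. *)
  assert (Q1 : forall i, (i < k)%nat -> sll (a i) h).
  { intros i H.
    assert (S1 : sll (a i) c) by (apply sll_of_osc; [lia|auto]).
    intros x y Hx Hy; apply (S1 x y Hx).
    destruct (standard_ends c Sc) as (x0 & y0 & Ec), (standard_ends h Sh) as (x1 & y1 & Eh).
    apply (ends_ext _ _ _ Ec); apply (ends_ext _ _ _ Eh) in Hy.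
    assert (x0 <= x1 /\ y1 <= y0); [|lra].
    clear - Ec Eh Hc Sc.
    destruct (circ_shape c h Sc Hc) as [(b0 & m & b1 & E & Nm & Eqh & _)|(p & b & mk & E & _ & Eqh & _)];
    destruct Eh as (_ & Ch & _); rewrite Eqh in Ch.
    - destruct Ec as (_ & Cc & _); rewrite E in Cc; destruct Cc as (C0 & C1 & C2).
      apply chain_app in C2; destruct C2 as (z & C2 & C3).
      destruct (exists_last Nm) as (m' & d & ->).
      apply chain_app in C2, Ch; destruct C2 as (w & C2 & C4), Ch as (w' & C5 & C6).
      simpl in C3, C4, C6.
      split; [|lra].
      destruct m' as [|e m']; simpl in C2, C5; lra.
    - simpl in Ch.
      assert (Ib : In b (orbs c)) by (rewrite E; apply in_elt).
      pose proof (ends_in _ _ _ _ Ec Ib).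
      destruct Sc as (Mc & _); destruct (marked_mbump c b Mc Ib); lra. }
  assert (Q2 : forall i, (k <= i < length A)%nat -> slt h (a i) /\ osc (a i) c = S (osc h (a i))).
  { intros i H; pose proof (pair_c i ltac:(lia)) as P.
    pose proof (std_a i ltac:(lia)) as Sa.
    pose proof (std_pair_noclash _ _ Sa Sc P) as Nc.
    pose proof (ssub_of_osc i ltac:(lia) ltac:(apply K2; lia)) as Sub.
    assert (Lt : slt h (a i)).
    { inversion P as [? ? _ K|? ? h' _ K C Q].
      - exfalso; exact (sll_not_ssub _ _ Sa Sc K Sub).
      - apply std_pair_slt in Q.
        destruct (circ_same_slt c h' h (a i) Sc Sa C Hc) as (R1 & R2 & _).
        destruct Q; [left|right]; auto. }
    split; [exact Lt|apply osc_circ; auto]. }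
  exists L; split; [|split].
  - unfold L; rewrite <- (firstn_skipn k A) at 3; rewrite <- app_assoc.
    apply Permutation_app_head; apply Permutation_cons_append.
  - intros i j H; rewrite LL in H.
    destruct (Nat.lt_trichotomy i k) as [Hi|[->|Hi]].
    + rewrite N1 by lia; destruct (Nat.lt_trichotomy j k) as [Hj|[->|Hj]].
      * rewrite N1 by lia; apply pair_a; lia.
      * rewrite N2; left; auto.
      * destruct j as [|j]; [lia|]; rewrite N3 by lia; apply pair_a; lia.
    + rewrite N2; destruct j as [|j]; [lia|]; rewrite N3 by lia; apply Q2; lia.
    + destruct i as [|i]; [lia|]; destruct j as [|j]; [lia|]; rewrite !N3 by lia.
      apply pair_a; lia.
  - assert (IR : rotrel (S (length A) - k) (fun i j => sig full (k + i)%nat (k + j)%nat)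
              (S (length A) - k) (fun i j => sigZ L (k + i)%nat (k + j)%nat)).
    { apply rot_indec; [lia|..].
      - intros m (Lm & Hm).
        (* A split at [m] would give the element just below it the value 0 against [c], which sits
           at the last index. *)
        specialize (Hm (m - 1)%nat (S (length A) - k - 1)%nat ltac:(lia) ltac:(lia)).
        unfold sig in Hm; rewrite nth_full_l in Hm by lia.
        replace (k + (S (length A) - k - 1))%nat with (length A) in Hm by lia.
        rewrite nth_full_r in Hm; specialize (K2 (k + (m - 1))%nat ltac:(lia)); lia.
      - intros i Li; unfold sigZ, sig; rewrite Nat.add_0_r, N2, Nat.add_succ_r, N3 by lia.
        replace (k + (S (length A) - k - 1))%nat with (length A) by lia.
        rewrite nth_full_r, nth_full_l by lia.
        destruct (Q2 (k + i)%nat ltac:(lia)) as [_ ->]; lia.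
      - intros i j L1 L2; unfold sigZ, sig; rewrite !Nat.add_succ_r, !N3 by lia.
        rewrite !nth_full_l by lia; reflexivity. }
    rewrite Lf, LL; destruct (Nat.eq_dec k 0) as [->|Nk].
    + rewrite Nat.sub_0_r in IR; exact IR.
    + replace (S (length A)) with (k + (S (length A) - k))%nat at 2 by lia.
      apply (rot_dec _ _ k _ (fun i j => sigZ L (k + i)%nat (k + j)%nat)); auto.
      * split; [lia|]; intros i j L1 L2; apply (split_at_threshold k); auto; lia.
      * intros i j L1 L2; unfold sigZ, sig; rewrite !N1, !nth_full_l by lia; reflexivity.
      * intros i j L1 L2; unfold sigZ, sig; rewrite N1 by lia.
        destruct (Nat.eq_dec j k) as [->|Nj].
        -- rewrite N2, sll_osc; auto; apply std_a; lia.
        -- destruct j as [|j]; [lia|]; rewrite N3 by lia.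
           rewrite sll_osc; auto; try (apply std_a; lia).
           apply (sll_below k); auto; lia.
Qed.

End Rotation.

(** * Nesting a standard function between two outer bumps *)

(** The bump on [(u, v)] that sends [p] to [q] and is affine on either side of [p]; its sign is that
    of [q - p], and exchanging [p] and [q] inverts it. *)
Definition pl (u v p q t : R) : R :=
  if Rle_dec t u then t
  else if Rle_dec t p then u + (t - u) * ((q - u) / (p - u))
  else if Rle_dec t v then v - (v - t) * ((v - q) / (v - p))
  else t.

Section PiecewiseLinear.
Variables u v p q : R.
Hypotheses (Hp : u < p < v) (Hq : u < q < v).

Lemma pl_slopes : exists k l, k = (q - u) / (p - u) /\ l = (v - q) / (v - p) /\
  0 < k /\ 0 < l /\ (p - u) * k = q - u /\ (v - p) * l = v - q.
Proof.
  exists ((q - u) / (p - u)), ((v - q) / (v - p)).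
  repeat split; try (apply Rdiv_lt_0_compat; lra); field; lra.
Qed.

Lemma pl_mono x y : x < y -> pl u v p q x < pl u v p q y.
Proof.
  intros L; unfold pl; destruct pl_slopes as (k & l & <- & <- & K & M & E1 & E2).
  destruct (Rle_dec x u), (Rle_dec y u), (Rle_dec x p), (Rle_dec y p), (Rle_dec x v), (Rle_dec y v);
    try lra; nra.
Qed.

Lemma pl_out t : t <= u \/ v <= t -> pl u v p q t = t.
Proof.
  intros L; unfold pl.
  destruct (Rle_dec t u), (Rle_dec t p), (Rle_dec t v); try lra.
  replace t with v by lra; lra.
Qed.

Lemma pl_mid : pl u v p q p = q.
Proof.
  unfold pl; destruct (Rle_dec p u), (Rle_dec p p); try lra; field; lra.
Qed.

Lemma pl_pos t : p < q -> u < t < v -> t < pl u v p q t.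
Proof.
  intros L Ht; unfold pl; destruct pl_slopes as (k & l & <- & <- & K & M & E1 & E2).
  destruct (Rle_dec t u), (Rle_dec t p), (Rle_dec t v); try lra.
  - assert (1 < k) by nra; nra.
  - assert (l < 1) by nra; nra.
Qed.

Lemma pl_neg t : q < p -> u < t < v -> pl u v p q t < t.
Proof.
  intros L Ht; unfold pl; destruct pl_slopes as (k & l & <- & <- & K & M & E1 & E2).
  destruct (Rle_dec t u), (Rle_dec t p), (Rle_dec t v); try lra.
  - assert (k < 1) by nra; nra.
  - assert (1 < l) by nra; nra.
Qed.
End PiecewiseLinear.

Lemma pl_inv u v p q t : u < p < v -> u < q < v -> pl u v p q (pl u v q p t) = t.
Proof.
  intros Hp Hq.
  destruct (Rle_lt_dec t u) as [L|L]; [rewrite !pl_out; auto; rewrite pl_out; auto|].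
  destruct (Rle_lt_dec v t) as [M|M]; [rewrite !pl_out; auto; rewrite pl_out; auto|].
  pose proof (pl_mono u v q p Hq Hp _ _ L) as A; rewrite pl_out in A by lra.
  pose proof (pl_mono u v q p Hq Hp _ _ M) as B; rewrite (pl_out u v q p Hq v) in B by lra.
  destruct (Rle_lt_dec t q) as [N|N].
  - assert (C : pl u v q p t <= p).
    { destruct N as [N| ->]; [|rewrite pl_mid by auto; lra].
      apply (pl_mono u v q p Hq Hp) in N; rewrite pl_mid in N by auto; lra. }
    assert (D : pl u v q p t = u + (t - u) * ((p - u) / (q - u))).
    { unfold pl; destruct (Rle_dec t u), (Rle_dec t q); lra. }
    unfold pl at 1; destruct (Rle_dec _ u); [lra|]; destruct (Rle_dec _ p); [|lra].
    rewrite D; field; lra.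
  - assert (C : p < pl u v q p t).
    { apply (pl_mono u v q p Hq Hp) in N; rewrite pl_mid in N by auto; lra. }
    assert (D : pl u v q p t = v - (v - t) * ((v - p) / (v - q))).
    { unfold pl; destruct (Rle_dec t u), (Rle_dec t q), (Rle_dec t v); lra. }
    unfold pl at 1; destruct (Rle_dec _ u); [lra|]; destruct (Rle_dec _ p); [lra|].
    destruct (Rle_dec _ v); [|lra].
    rewrite D; field; lra.
Qed.

Lemma pl_homeo u v p q : 0 <= u -> v <= 1 -> u < p < v -> u < q < v -> homeo (pl u v p q).
Proof.
  intros H0 H1 Hp Hq.
  assert (I : forall p q, u < p < v -> u < q < v -> forall x, inI x -> inI (pl u v p q x)).
  { clear p q Hp Hq; intros p q Hp Hq x [X0 X1]; split.
    - destruct X0 as [X0|<-]; [|rewrite pl_out; lra].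
      apply (pl_mono u v p q Hp Hq) in X0; rewrite pl_out in X0; lra.
    - destruct X1 as [X1| ->]; [|rewrite pl_out; lra].
      apply (pl_mono u v p q Hp Hq) in X1; rewrite (pl_out u v p q Hp 1) in X1; lra. }
  split; [|split].
  - intros x y _ L _; apply pl_mono; auto.
  - apply I; auto.
  - intros y Hy; exists (pl u v q p y); split; [apply I; auto|apply pl_inv; auto].
Qed.

(** * Gluing maps at a common fixed point *)

Definition glue (f g : R -> R) (z t : R) : R := if Rlt_dec t z then f t else g t.

Lemma glue_l f g z t : f z = z -> g z = z -> t <= z -> glue f g z t = f t.
Proof.
  intros F G L; unfold glue; destruct (Rlt_dec t z); [reflexivity|].
  replace t with z by lra; congruence.
Qed.

Lemma glue_r f g z t : z <= t -> glue f g z t = g t.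
Proof. intros L; unfold glue; destruct (Rlt_dec t z); [lra|reflexivity]. Qed.

Lemma glue_homeo f g z :
  homeo f -> homeo g -> inI z -> f z = z -> g z = z -> homeo (glue f g z).
Proof.
  intros Hf Hg [Z0 Z1] Fz Gz.
  assert (L := fun t => glue_l f g z t Fz Gz).
  assert (R := glue_r f g z).
  split; [|split].
  - intros x y H0 H H1; destruct (Rle_lt_dec y z) as [K|K].
    + rewrite !L by lra; apply Hf; auto.
    + rewrite (R y) by lra; destruct (Rle_lt_dec z x) as [M|M].
      * rewrite R by lra; apply Hg; auto.
      * rewrite L by lra; apply Rlt_trans with z.
        -- rewrite <- Fz; apply Hf; auto.
        -- rewrite <- Gz at 1; apply Hg; auto.
  - intros x Hx; unfold glue; destruct (Rlt_dec x z); [apply Hf|apply Hg]; exact Hx.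
  - intros y [Y0 Y1]; destruct (Rle_lt_dec y z) as [K|K].
    + destruct Hf as (Hm & HI & Hs) eqn:EH; destruct (Hs y) as (x & Ix & <-); [split; lra|].
      exists x; split; [exact Ix|]; apply L.
      apply (homeo_le_inv f); auto; [split; lra|lra].
    + destruct Hg as (Hm & HI & Hs) eqn:EH; destruct (Hs y) as (x & Ix & <-); [split; lra|].
      exists x; split; [exact Ix|]; apply R.
      apply (homeo_le_inv g); auto; [split; lra|lra].
Qed.

Lemma chain_sorted x l y : chain x l y -> forall i j, (i < j < length l)%nat ->
  bv (nth i l morb_default) <= bu (nth j l morb_default).
Proof.
  revert x; induction l as [|b l IH]; intros x C i j H; simpl in H; [lia|].
  destruct C as (C1 & C2 & C3); destruct j as [|j]; [lia|]; destruct i as [|i]; simpl.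
  - apply (chain_in _ _ _ _ C3), nth_In; lia.
  - apply (IH _ C3); lia.
Qed.

Lemma ends_fixed f x y : ends f x y -> 0 <= x /\ y <= 1 /\ mf f x = x /\ mf f y = y.
Proof.
  intros (Mf & C & N).
  destruct (exists_last N) as (l & d & E).
  assert (Id : In d (orbs f)) by (rewrite E; apply in_elt).
  destruct (marked_mbump f d Mf Id) as [(_ & _ & V1 & _ & Fv & _) _].
  assert (Q : bv d = y).
  { rewrite E in C; apply chain_app in C; destruct C as (z & _ & C); simpl in C; tauto. }
  destruct (orbs f) as [|b l'] eqn:E'; [congruence|].
  assert (Ib : In b (orbs f)) by (rewrite E'; left; reflexivity).
  destruct (marked_mbump f b Mf Ib) as [(U0 & _ & _ & Fu & _) _].
  destruct C as (Q' & _); rewrite Q, Q' in *; auto.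
Qed.

Section Nest.
Variables (h : MF) (a b u s t0 s' t' v : R).
Hypotheses (Sh : standard h) (Eh : ends h a b)
  (Hu : 0 <= u) (Hs : u < s) (Hst : s < t0) (Ht : t0 < a)
  (Hs' : b < s') (Hst' : s' < t') (Ht' : t' < v) (Hv : v <= 1).

(** The marker of a negative bump is the image of the start of its right foot, so the left piece
    sends [t0] to the marker [s]; the positive right piece sends the marker [s'] to [t']. The inner
    boundaries of all four new feet are thus free parameters. *)
Definition nest : MF :=
  MkMF (glue (pl u a t0 s) (glue (mf h) (pl b v s' t') b) a)
       (MOrb u a s :: orbs h ++ MOrb b v s' :: nil).

Let ab : a < b := ends_lt _ _ _ Eh.

Lemma nest_fix : pl u a t0 s a = a /\ mf h a = a /\ mf h b = b /\ pl b v s' t' b = b.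
Proof.
  pose proof ab; destruct (ends_fixed _ _ _ Eh) as (_ & _ & A & B).
  repeat split; auto; apply pl_out; lra.
Qed.

Lemma nest_l t : t <= a -> mf nest t = pl u a t0 s t.
Proof.
  intros L; pose proof ab; destruct nest_fix as (F1 & F2 & F3 & F4).
  simpl; apply glue_l; auto; rewrite glue_l; auto; lra.
Qed.

Lemma nest_m t : a <= t <= b -> mf nest t = mf h t.
Proof.
  intros L; pose proof ab; destruct nest_fix as (F1 & F2 & F3 & F4).
  simpl; rewrite glue_r by lra; apply glue_l; auto; lra.
Qed.

Lemma nest_r t : b <= t -> mf nest t = pl b v s' t' t.
Proof. intros L; pose proof ab; simpl; rewrite !glue_r by lra; reflexivity. Qed.

Lemma nest_homeo : homeo (mf nest).
Proof.
  pose proof ab; destruct nest_fix as (F1 & F2 & F3 & F4).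
  destruct (ends_fixed _ _ _ Eh) as (A0 & B1 & _).
  apply glue_homeo; auto; [apply pl_homeo; lra| |split; lra|].
  - apply glue_homeo; auto; [apply Sh|apply pl_homeo; lra|split; lra].
  - rewrite glue_l; auto; lra.
Qed.

Lemma nest_neg : neg_on (mf nest) u a.
Proof. intros t L; rewrite nest_l by lra; apply pl_neg; lra. Qed.

Lemma nest_pos : pos_on (mf nest) b v.
Proof. intros t L; rewrite nest_r by lra; apply pl_pos; lra. Qed.

Lemma nest_inner d t : In d (orbs h) -> bu d < t < bv d -> mf nest t = mf h t.
Proof. intros I L; pose proof (ends_in _ _ _ _ Eh I); apply nest_m; lra. Qed.

Lemma nest_chain : chain u (orbs nest) v.
Proof.
  split; [reflexivity|]; split; [simpl; lra|].
  apply chain_app; exists b; split; [apply Eh|simpl; repeat split; lra].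
Qed.

Lemma nest_marked : marked nest.
Proof.
  pose proof ab; destruct (ends_fixed _ _ _ Eh) as (A0 & B1 & Fa & Fb).
  split; [exact nest_homeo|split; [|split]].
  - intros d [<-|Id]; [|apply in_app_iff in Id; destruct Id as [Id|[<-|[]]]]; cbn [bu bv bs].
    + split; [|lra].
      split; [lra|split; [lra|split; [lra|split; [|split]]]].
      * rewrite nest_l, pl_out; lra.
      * rewrite nest_l, pl_out; lra.
      * intros t L; pose proof (nest_neg t L); lra.
    + assert (Mh : marked h) by apply Sh.
      destruct (marked_mbump h d Mh Id) as [(U0 & UV & V1 & Fu & Fv & Hne) K].
      pose proof (ends_in _ _ _ _ Eh Id).
      split; [|exact K].
      repeat (split; [first [assumption | rewrite nest_m by lra; assumption]|]).
      intros t L; rewrite nest_m by lra; apply Hne; exact L.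
    + split; [|lra].
      split; [lra|split; [lra|split; [lra|split; [|split]]]].
      * rewrite nest_r, pl_out; lra.
      * rewrite nest_r, pl_out; lra.
      * intros t L; pose proof (nest_pos t L); lra.
  - exact (chain_sorted _ _ _ nest_chain).
  - intros t [It Ne].
    destruct (Rle_lt_dec t a) as [L|L]; [|destruct (Rle_lt_dec b t) as [M|M]].
    + exists (MOrb u a s); split; [left; reflexivity|]; simpl.
      rewrite nest_l in Ne by lra.
      split; apply Rnot_le_lt; intros K; apply Ne, pl_out; lra.
    + exists (MOrb b v s'); split; [right; apply in_elt|]; simpl.
      rewrite nest_r in Ne by lra.
      split; apply Rnot_le_lt; intros K; apply Ne, pl_out; lra.
    + rewrite nest_m in Ne by lra.
      destruct Sh as ((_ & _ & _ & Hc) & _); destruct (Hc t) as (d & Id & K); [split; auto|].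
      exists d; split; [right; apply in_app_iff; auto|exact K].
Qed.

Lemma nest_ends : ends nest u v.
Proof. split; [exact nest_marked|split; [exact nest_chain|discriminate]]. Qed.

Lemma nest_standard : standard nest.
Proof.
  pose proof ab.
  split; [exact nest_marked|split; [exact (ends_interval _ _ _ nest_ends)|split]].
  - intros c d Ic Id P N.
    destruct Sh as (_ & _ & Ord & _).
    assert (Sg : forall e, In e (orbs h) ->
       (pos_on (mf nest) (bu e) (bv e) -> pos_on (mf h) (bu e) (bv e)) /\
       (neg_on (mf nest) (bu e) (bv e) -> neg_on (mf h) (bu e) (bv e))).
    { intros e Ie; split; [apply pos_on_agree|apply neg_on_agree]; intros t L;
        apply (nest_inner e); auto. }
    destruct Ic as [<-|Ic].
    { exfalso; cbn [bu bv] in P; apply (not_pos_and_neg (mf nest) u a ltac:(lra) P nest_neg). }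
    apply in_app_iff in Ic; destruct Id as [<-|Id].
    { cbn [bv]; destruct Ic as [Ic|[<-|[]]]; [pose proof (ends_in _ _ _ _ Eh Ic); lra|simpl; lra]. }
    apply in_app_iff in Id; destruct Id as [Id|[<-|[]]].
    + pose proof (ends_in _ _ _ _ Eh Id).
      destruct Ic as [Ic|[<-|[]]]; [|simpl; lra].
      apply Ord; auto; apply Sg; auto.
    + exfalso; cbn [bu bv] in N; apply (not_pos_and_neg (mf nest) b v ltac:(lra) nest_pos N).
  - destruct Sh as (_ & _ & _ & Cn).
    change (npos h) with (np (mf h) (orbs h)) in Cn.
    change (nneg h) with (nn (mf h) (orbs h)) in Cn.
    change (npos nest) with (np (mf nest) (MOrb u a s :: orbs h ++ MOrb b v s' :: nil)).
    change (nneg nest) with (nn (mf nest) (MOrb u a s :: orbs h ++ MOrb b v s' :: nil)).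
    rewrite np_cons_neg, nn_cons_neg, np_app, nn_app by (exact nest_neg || (simpl; lra)).
    rewrite np_cons_pos, nn_cons_pos by (exact nest_pos || (simpl; lra)).
    destruct (np_nn_agree (mf nest) (mf h) (orbs h)) as [-> ->]; [exact nest_inner|].
    change (np (mf nest) nil) with 0%nat; change (nn (mf nest) nil) with 0%nat; lia.
Qed.

Lemma nest_circ : circ nest h.
Proof.
  assert (Mh : marked h) by apply Sh; split; [exact Mh|].
  pose proof Eh as (_ & _ & N).
  left; simpl orbs; split; [|split].
  - simpl; rewrite length_app; simpl; destruct (orbs h); [congruence|simpl; lia].
  - simpl; rewrite removelast_last; reflexivity.
  - intros t It; split.
    + intros (d & Id & K); symmetry; apply (nest_inner d); auto.
    + intros K; apply NNPP; intros Ne; apply K, Mh; split; auto.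
Qed.

Lemma nest_feet d t : In d (orbs nest) -> in_foot nest d t ->
  u < t < s \/ t0 <= t < a \/ b < t < s' \/ t' <= t < v \/
  exists e, In e (orbs h) /\ in_foot h e t.
Proof.
  pose proof ab.
  intros [<-|Id] F; [|apply in_app_iff in Id; destruct Id as [Id|[<-|[]]]].
  - destruct F as [F|(ta & [[P _]|(_ & Ita & Q)] & F)]; cbn [bu bv bs] in *; [auto| |].
    + exfalso; apply (not_pos_and_neg (mf nest) u a ltac:(lra) P nest_neg).
    + right; left; assert (Q0 : mf nest t0 = s) by (rewrite nest_l, pl_mid; lra).
      destruct (ends_fixed _ _ _ Eh) as (A0 & B1 & _).
      assert (t0 <= ta); [|lra].
      apply (homeo_le_inv (mf nest)); auto; [exact nest_homeo|split; lra|lra].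
  - do 4 right; exists d; split; [exact Id|].
    apply (in_foot_agree nest h); auto.
    + exact nest_homeo.
    + apply marked_mbump; [exact nest_marked|right; apply in_app_iff; auto].
    + intros r L; apply (nest_inner d); auto.
  - destruct F as [F|(ta & [[P Q]|(N & _ & Q)] & F)]; cbn [bu bv bs] in *; [auto| |].
    + rewrite nest_r, pl_mid in Q by lra; subst; auto.
    + exfalso; apply (not_pos_and_neg (mf nest) b v ltac:(lra) nest_pos N).
Qed.
End Nest.

(** * Realization *)

Lemma rstart_ex f b : homeo (mf f) -> mbump f b -> exists ta, rstart f b ta.
Proof.
  intros Hf [O K]; destruct (homeo_orbital_sign _ _ _ Hf O) as [P|N].
  - exists (mf f (bs b)); left; auto.
  - destruct Hf as (_ & _ & Hs), O as (U0 & _ & V1 & _).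
    destruct (Hs (bs b)) as (ta & Ita & Q); [split; lra|].
    exists ta; right; auto.
Qed.

(** Feet come arbitrarily close to both ends of a function, so a point at a distance from all feet
    is at the same distance from the ends. *)
Lemma foot_near_left f x y e :
  ends f x y -> 0 < e -> exists b t, In b (orbs f) /\ in_foot f b t /\ x < t < x + e.
Proof.
  intros (Mf & C & N) He; destruct (orbs f) as [|b l] eqn:E; [congruence|].
  assert (Ib : In b (orbs f)) by (rewrite E; left; reflexivity).
  destruct (marked_mbump f b Mf Ib) as [_ K]; destruct C as (Q & _).
  exists b, (x + Rmin (e/2) ((bs b - x)/2)); split; [left; reflexivity|].
  destruct (Rmin_cases (e/2) ((bs b - x)/2)) as [[? ->]|[? ->]]; (split; [left; lra|lra]).
Qed.

Lemma foot_near_right f x y e :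
  ends f x y -> 0 < e -> exists b t, In b (orbs f) /\ in_foot f b t /\ y - e < t < y.
Proof.
  intros (Mf & C & N) He; destruct (exists_last N) as (l & b & E).
  assert (Ib : In b (orbs f)) by (rewrite E; apply in_elt).
  assert (Q : bv b = y).
  { rewrite E in C; apply chain_app in C; destruct C as (z & _ & C); simpl in C; tauto. }
  pose proof (marked_mbump f b Mf Ib) as Mb.
  destruct (rstart_ex f b (proj1 Mf) Mb) as (ta & Hta).
  pose proof (rstart_inside f b ta (proj1 Mf) Mb Hta) as K.
  exists b, (y - Rmin (e/2) (y - ta)); split; [exact Ib|].
  destruct (Rmin_cases (e/2) (y - ta)) as [[? ->]|[? ->]];
    (split; [right; exists ta; split; [exact Hta|lra]|lra]).
Qed.

Definition avoids (f : MF) (z e : R) : Prop :=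
  forall b t, In b (orbs f) -> in_foot f b t -> e <= Rabs (t - z).

Lemma avoids_ends f x y z e :
  ends f x y -> avoids f z e -> e <= Rabs (x - z) /\ e <= Rabs (y - z).
Proof.
  intros E H; split; apply Rnot_lt_le; intros L.
  - destruct (foot_near_left f x y (e - Rabs (x - z)) E) as (b & t & Ib & F & K); [lra|].
    specialize (H b t Ib F).
    pose proof (Rabs_triang (t - x) (x - z)).
    replace (t - x + (x - z)) with (t - z) in H0 by ring.
    rewrite (Rabs_pos_eq (t - x)) in H0 by lra; lra.
  - destruct (foot_near_right f x y (e - Rabs (y - z)) E) as (b & t & Ib & F & K); [lra|].
    specialize (H b t Ib F).
    pose proof (Rabs_triang (t - y) (y - z)).
    replace (t - y + (y - z)) with (t - z) in H0 by ring.
    rewrite (Rabs_left1 (t - y)) in H0 by lra; lra.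
Qed.

(* The ends of f keep a distance from the feet of g: the condition, beyond
   being a standard pair, that leaves room for two outer bumps around f. *)
Definition isolated (f g : MF) : Prop :=
  forall x y, ends f x y -> exists e, 0 < e /\ avoids g x e /\ avoids g y e.

Definition good_pair (f g : MF) : Prop :=
  slt f g /\ std_pair f g /\ isolated f g /\ isolated g f.

Definition inside (al be : R) (f : MF) : Prop :=
  exists x y, ends f x y /\ al < x /\ y < be.

(** The induction invariant for realization, stronger than [in_S]. The prescribed interval allows
    both placing sums side by side and leaving margins for outer bumps. *)
Definition packed (al be : R) (A : list MF) : Prop :=
  (forall f, In f A -> standard f /\ inside al be f) /\ ForallOrdPairs good_pair A.

Lemma ForallOrdPairs_nth {T} (P : T -> T -> Prop) d l i j :
  ForallOrdPairs P l -> (i < j < length l)%nat -> P (nth i l d) (nth j l d).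
Proof.
  intros H; revert i j; induction H as [|a l F H IH]; simpl; intros i j L; [lia|].
  destruct j as [|j]; [lia|]; destruct i as [|i].
  - rewrite Forall_forall in F; apply F, nth_In; lia.
  - apply IH; lia.
Qed.

Lemma ForallOrdPairs_app {T} (P : T -> T -> Prop) l l' :
  ForallOrdPairs P l -> ForallOrdPairs P l' -> (forall a b, In a l -> In b l' -> P a b) ->
  ForallOrdPairs P (l ++ l').
Proof.
  intros H H'; induction H as [|a l F H IH]; simpl; intros K; [exact H'|].
  constructor.
  - rewrite Forall_forall in F |- *; intros b Ib; apply in_app_iff in Ib; destruct Ib; auto.
  - apply IH; auto.
Qed.

Lemma packed_in_S al be A : packed al be A -> in_S A.
Proof.
  intros [H1 H2]; split; [apply H1|].
  intros i j L; pose proof (ForallOrdPairs_nth good_pair mf_default A i j H2 L) as (K1 & K2 & _); auto.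
Qed.

Lemma ends_unique f x y x' y' : ends f x y -> ends f x' y' -> x = x' /\ y = y'.
Proof.
  intros E E'.
  pose proof (ends_ext _ _ _ E) as H; pose proof (ends_ext _ _ _ E') as H'.
  pose proof (ends_lt _ _ _ E); pose proof (ends_lt _ _ _ E').
  destruct E as (_ & C & N), E' as (_ & C' & _).
  split.
  - destruct (orbs f); [congruence|]; simpl in C, C'; destruct C as (<- & _), C' as (<- & _); auto.
  - destruct (exists_last N) as (l & d & E); rewrite E in C, C'.
    apply chain_app in C, C'; destruct C as (? & _ & C), C' as (? & _ & C'); simpl in C, C'; intuition congruence.
Qed.

Lemma uniform_radius (P : MF -> R -> Prop) (L : list MF) :
  (forall a e e', P a e -> 0 < e' <= e -> P a e') ->
  (forall a, In a L -> exists e, 0 < e /\ P a e) ->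
  exists e, 0 < e /\ forall a, In a L -> P a e.
Proof.
  intros M; induction L as [|a L IH]; intros H.
  - exists 1; split; [lra|intros a []].
  - destruct IH as (e & He & K); [intros b Ib; apply H; right; exact Ib|].
    destruct (H a (or_introl eq_refl)) as (e' & He' & K').
    exists (Rmin e e'); pose proof (Rmin_l e e'); pose proof (Rmin_r e e').
    assert (0 < Rmin e e') by (apply Rmin_pos; lra).
    split; [lra|]; intros b [<-|Ib]; eapply M; eauto.
Qed.

Lemma avoids_le f z e e' : avoids f z e -> e' <= e -> avoids f z e'.
Proof. intros H L b t Ib F; specialize (H b t Ib F); lra. Qed.

Lemma nest_exists al be al' be' h L :
  0 <= al -> be <= 1 -> al < al' -> be' < be -> packed al' be' (h :: L) ->
  exists c, standard c /\ inside al be c /\ circ c h /\ forall f, In f L -> ssub f c /\ good_pair f c.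
Proof.
  intros H0 H1 La Lb [HS HP].
  destruct (HS h (or_introl eq_refl)) as (Sh & a & b & Eh & Ka & Kb).
  pose proof (ends_lt _ _ _ Eh) as ab.
  assert (HL : forall f, In f L -> good_pair h f).
  { inversion HP as [|? ? F _]; subst; rewrite Forall_forall in F; exact F. }
  destruct (uniform_radius (fun f e => avoids f a e /\ avoids f b e) L) as (e0 & He0 & Av).
  { intros f e e' [A B] K; split; eapply avoids_le; eauto; lra. }
  { intros f If; destruct (HL f If) as (_ & _ & I & _); apply I; exact Eh. }
  (* The last two bounds keep the inner feet inside [(al', be')], hence apart from the outer
     feet. *)
  set (e := Rmin e0 (Rmin (a - al') (be' - b))).
  assert (He : 0 < e /\ e <= e0 /\ e <= a - al' /\ e <= be' - b).
  { unfold e; pose proof (Rmin_l e0 (Rmin (a - al') (be' - b)));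
    pose proof (Rmin_r e0 (Rmin (a - al') (be' - b)));
    pose proof (Rmin_l (a - al') (be' - b)); pose proof (Rmin_r (a - al') (be' - b)).
    split; [repeat apply Rmin_pos; lra|lra]. }
  clearbody e.
  (* Only half of the gap is used: the other half keeps the ends of the functions in [L] away from
     the new feet, so that isolation survives. *)
  set (u := al + (al' - al)/3); set (s := al + 2 * (al' - al)/3); set (t0 := a - e/2).
  set (v := be - (be - be')/3); set (t' := be - 2 * (be - be')/3); set (s' := b + e/2).
  assert (U : al < u /\ u < s /\ s < al' /\ be' < t' /\ t' < v /\ v < be) by (unfold u, s, v, t'; lra).
  assert (T : al' < t0 /\ s' < be') by (unfold t0, s'; lra).
  set (c := nest h a b u s t0 s' t' v).
  assert (Sc : standard c) by (apply nest_standard; auto; unfold t0, s' in *; lra).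
  assert (Ec : ends c u v) by (apply nest_ends; auto; unfold t0, s' in *; lra).
  assert (Cc : circ c h) by (apply nest_circ; auto; unfold t0, s' in *; lra).
  assert (Fc : forall d t, In d (orbs c) -> in_foot c d t ->
     u < t < s \/ t0 <= t < a \/ b < t < s' \/ t' <= t < v \/
     exists e, In e (orbs h) /\ in_foot h e t).
  { intros d t Id F; apply (nest_feet h a b u s t0 s' t' v) with (d := d); auto;
      unfold t0, s' in *; lra. }
  clearbody c.
  exists c; split; [exact Sc|split; [exists u, v; split; [exact Ec|lra]|split; [exact Cc|]]].
  intros f If.
  destruct (HS f (or_intror If)) as (Sf & x & y & Ef & Kx & Ky).
  destruct (HL f If) as (_ & Phf & _ & Ifh).
  destruct (Av f If) as [Ava Avb].
  assert (Sub : ssub f c) by (apply (ssub_ends _ _ _ _ _ _ Ef Ec); lra).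
  split; [exact Sub|]; split; [right; exact Sub|split; [|split]].
  - apply (sp_sub f c h); auto.
    apply fast_pair; [apply Sf|apply Sc|].
    intros d1 d2 I1 I2 t [F1 F2].
    pose proof (ends_foot _ _ _ _ _ Ef I1 F1) as Kt.
    pose proof (Ava d1 t I1 F1) as A1; pose proof (Avb d1 t I1 F1) as A2.
    apply (Fc d2 t I2) in F2; destruct F2 as [F2|[F2|[F2|[F2|(d & Id & F2)]]]]; try lra.
    + rewrite Rabs_left in A1 by lra; unfold t0 in F2; lra.
    + rewrite Rabs_right in A2 by lra; unfold s' in F2; lra.
    + apply (std_pair_noclash h f Sh Sf Phf d d1 Id I1 t); auto.
  - intros x' y' E'; destruct (ends_unique _ _ _ _ _ Ef E') as [<- <-].
    destruct (Ifh x y Ef) as (eh & Heh & Hx & Hy).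
    destruct (avoids_ends f x y a e0 Ef Ava) as [X1 Y1].
    destruct (avoids_ends f x y b e0 Ef Avb) as [X2 Y2].
    set (m := Rmin (Rmin eh (e/2)) (Rmin (x - al') (be' - y))).
    assert (Hm : 0 < m /\ m <= eh /\ m <= e/2 /\ m <= x - al' /\ m <= be' - y).
    { unfold m; pose proof (Rmin_l (Rmin eh (e/2)) (Rmin (x - al') (be' - y)));
      pose proof (Rmin_r (Rmin eh (e/2)) (Rmin (x - al') (be' - y)));
      pose proof (Rmin_l (x - al') (be' - y)); pose proof (Rmin_r (x - al') (be' - y)).
      pose proof (Rmin_l eh (e/2)); pose proof (Rmin_r eh (e/2)).
      split; [repeat apply Rmin_pos; lra|lra]. }
    clearbody m; pose proof (ends_lt _ _ _ Ef).
    assert (G : forall z, al' < z < be' -> avoids h z eh -> e <= Rabs (z - a) -> e <= Rabs (z - b) ->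
                m <= z - al' -> m <= be' - z -> avoids c z m).
    { intros z Kz Ah Za Zb M1 M2 d t Id F.
      apply (Fc d t Id) in F; destruct F as [F|[F|[F|[F|(d' & Id' & F)]]]].
      - rewrite Rabs_left by lra; lra.
      - unfold t0 in F; revert Za; unfold Rabs.
        destruct (Rcase_abs (z - a)), (Rcase_abs (t - z)); lra.
      - unfold s' in F; revert Zb; unfold Rabs.
        destruct (Rcase_abs (z - b)), (Rcase_abs (t - z)); lra.
      - rewrite Rabs_right by lra; lra.
      - specialize (Ah d' t Id' F); lra. }
    exists m; split; [lra|split; apply G; auto; lra].
  - intros u' v' E'; destruct (ends_unique _ _ _ _ _ Ec E') as [<- <-].
    exists (Rmin (al' - u) (v - be')); split; [apply Rmin_pos; lra|].
    pose proof (Rmin_l (al' - u) (v - be')); pose proof (Rmin_r (al' - u) (v - be')).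
    split; intros d t Id F; pose proof (ends_foot _ _ _ _ _ Ef Id F).
    + rewrite Rabs_right by lra; lra.
    + rewrite Rabs_left by lra; lra.
Qed.

Lemma good_pair_apart al mu be f g :
  standard f -> standard g -> inside al mu f -> inside mu be g -> good_pair f g.
Proof.
  intros Sf Sg (x & y & E & K1 & K2) (x' & y' & E' & K1' & K2').
  pose proof (ends_lt _ _ _ E); pose proof (ends_lt _ _ _ E').
  assert (L : sll f g) by (apply (sll_ends _ _ _ _ _ _ E E'); lra).
  split; [left; exact L|split; [|split]].
  - apply sp_ll; [|exact L]; apply fast_pair; [apply Sf|apply Sg|].
    intros b c Ib Ic t [F1 F2].
    pose proof (ends_foot _ _ _ _ _ E Ib F1); pose proof (ends_foot _ _ _ _ _ E' Ic F2); lra.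
  - intros p q Ep; destruct (ends_unique _ _ _ _ _ E Ep) as [<- <-].
    exists (x' - y); split; [lra|]; split; intros d t Id F;
      pose proof (ends_foot _ _ _ _ _ E' Id F); rewrite Rabs_right; lra.
  - intros p q Ep; destruct (ends_unique _ _ _ _ _ E' Ep) as [<- <-].
    exists (x' - y); split; [lra|]; split; intros d t Id F;
      pose proof (ends_foot _ _ _ _ _ E Id F); rewrite Rabs_left; lra.
Qed.

Lemma standard_single al be :
  0 <= al -> al < be -> be <= 1 -> exists f, standard f /\ inside al be f.
Proof.
  intros H0 L H1; set (d := (be - al)/6).
  assert (Hd : 0 < d /\ al + 6 * d = be) by (unfold d; lra); clearbody d.
  set (u := al + d); set (v := al + 4 * d); set (p := al + 2 * d); set (q := al + 3 * d).
  assert (K : al < u /\ u < p /\ p < q /\ q < v /\ v < be) by (unfold u, v, p, q; lra).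
  clearbody u v p q.
  set (f := MkMF (pl u v p q) (MOrb u v p :: nil)).
  assert (P : pos_on (mf f) u v) by (intros t Ht; apply pl_pos; lra).
  assert (C : chain u (orbs f) v) by (simpl; lra).
  assert (Mf : marked f).
  { split; [apply pl_homeo; lra|split; [|split]].
    - intros b [<-|[]]; cbn [bu bv bs]; split; [|lra].
      split; [lra|split; [lra|split; [lra|split; [|split]]]].
      + apply pl_out; lra.
      + apply pl_out; lra.
      + intros t Ht; pose proof (P t Ht); lra.
    - exact (chain_sorted _ _ _ C).
    - intros t [_ Ne]; exists (MOrb u v p); split; [left; reflexivity|]; cbn [bu bv].
      split; apply Rnot_le_lt; intros N; apply Ne, pl_out; lra. }
  assert (E : ends f u v) by (split; [exact Mf|split; [exact C|discriminate]]).
  exists f; split; [|exists u, v; split; [exact E|lra]].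
  split; [exact Mf|split; [exact (ends_interval _ _ _ E)|split]].
  - intros b c [<-|[]] [<-|[]] _ N; exfalso; apply (not_pos_and_neg (mf f) u v ltac:(lra) P N).
  - right; change (npos f) with (np (mf f) (MOrb u v p :: nil)).
    change (nneg f) with (nn (mf f) (MOrb u v p :: nil)).
    rewrite np_cons_pos, nn_cons_pos by (exact P || (simpl; lra)); reflexivity.
Qed.

(** * Rotation of abstract functions and the induction on their total *)

Fixpoint sumf (f : nat -> nat) (n : nat) : nat :=
  match n with O => O | S m => (sumf f m + f m)%nat end.

Definition total (F : nat -> nat -> nat) (n : nat) : nat :=
  sumf (fun j => sumf (fun i => F i j) j) n.

Lemma sumf_ext f g n : (forall i, (i < n)%nat -> f i = g i) -> sumf f n = sumf g n.
Proof.
  induction n as [|n IH]; simpl; intros H; [reflexivity|].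
  rewrite IH, H; auto.
Qed.

Lemma sumf_shift f n : sumf f (S n) = (f 0 + sumf (fun i => f (S i)) n)%nat.
Proof. induction n as [|n IH]; simpl in *; lia. Qed.

Lemma sumf_add f g n : sumf (fun i => f i + g i)%nat n = (sumf f n + sumf g n)%nat.
Proof. induction n as [|n IH]; simpl; lia. Qed.

Lemma sumf_lt f g n :
  (0 < n)%nat -> (forall i, (i < n)%nat -> f i < g i)%nat -> (sumf f n < sumf g n)%nat.
Proof.
  induction n as [|n IH]; intros L H; [lia|]; simpl.
  pose proof (H n ltac:(lia)); destruct n as [|n]; [simpl; lia|].
  specialize (IH ltac:(lia) ltac:(auto)); lia.
Qed.

(** The new least element is index 0 and the old ones move up by one; [j - 1] is a true predecessor
    because only pairs [i < j] matter. [m] is the old greatest element. *)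
Definition rot (F : nat -> nat -> nat) (m i j : nat) : nat :=
  match i with O => (F (j - 1) m - 1)%nat | S i' => F i' (j - 1)%nat end.

(** The values against the greatest element reappear as values of the least one, each lowered by 1;
    all others are kept. *)
Lemma total_rot F m :
  (0 < m)%nat -> (forall i, (i < m)%nat -> 0 < F i m)%nat ->
  (total (rot F m) (S m) < total F (S m))%nat.
Proof.
  intros L H; unfold total; rewrite sumf_shift; simpl.
  rewrite (sumf_ext _ (fun j => (F j m - 1) + sumf (fun i => F i j) j)%nat).
  - rewrite sumf_add.
    enough (sumf (fun j => F j m - 1)%nat m < sumf (fun j => F j m) m)%nat by lia.
    apply sumf_lt; [exact L|]; intros i Hi; specialize (H i Hi); lia.
  - intros j Lj; transitivity (sumf (fun i => rot F m i (S j)) (S j)); [reflexivity|].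
    rewrite sumf_shift; simpl; rewrite Nat.sub_0_r; reflexivity.
Qed.

Lemma indecomposable_pos F m i :
  bang (S m) F -> (forall k, ~ splitpt (S m) F k) -> (i < m)%nat -> (0 < F i m)%nat.
Proof.
  intros B N L; destruct (Nat.eq_dec (F i m) 0) as [Z|]; [exfalso|lia].
  assert (Dn : forall a b, (a < b < m)%nat -> F b m = 0%nat -> F a m = 0%nat).
  { intros a b La Zb; pose proof (B a b m ltac:(lia) ltac:(lia)) as [_ Q].
    rewrite Zb in Q; destruct (Nat.eq_dec (F a m) 0); [auto|].
    specialize (Q ltac:(lia)); lia. }
  assert (Ex : forall d, (d <= m)%nat -> exists k, (k <= d)%nat /\
      (forall a, (a < k)%nat -> F a m = 0%nat) /\ (forall b, (k <= b < d)%nat -> 0 < F b m)%nat).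
  { induction d as [|d IH]; intros Ld; [exists 0%nat; repeat split; intros; lia|].
    destruct IH as (k & K1 & K2 & K3); [lia|].
    destruct (Nat.eq_dec (F d m) 0) as [Zd|Zd].
    - exists (S d); split; [lia|split; [|intros; lia]].
      intros a La; destruct (Nat.eq_dec a d) as [->|]; [exact Zd|apply (Dn a d); auto; lia].
    - exists k; split; [lia|split; [exact K2|]].
      intros b Lb; destruct (Nat.eq_dec b d) as [->|]; [lia|apply K3; lia]. }
  destruct (Ex m (le_n _)) as (k & K1 & K2 & K3).
  assert (0 < k)%nat.
  { destruct (Nat.eq_dec k 0) as [->|]; [|lia]. specialize (K3 i ltac:(lia)); lia. }
  apply (N k); split; [lia|]; intros a b La Lb.
  destruct (Nat.eq_dec b m) as [->|]; [auto|].
  pose proof (B a b m ltac:(lia) ltac:(lia)) as [_ Q].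
  rewrite (K2 a La) in Q; specialize (K3 b ltac:(lia)); specialize (Q ltac:(lia)); lia.
Qed.

Lemma bang_rot F m :
  bang (S m) F -> (forall i, (i < m)%nat -> 0 < F i m)%nat -> bang (S m) (rot F m).
Proof.
  intros B P i j k [L1 L2] L3; destruct j as [|j]; [lia|]; destruct k as [|k]; [lia|].
  destruct i as [|i]; simpl; rewrite !Nat.sub_0_r.
  - pose proof (B j k m ltac:(lia) ltac:(lia)) as Q.
    pose proof (P j ltac:(lia)); pose proof (P k ltac:(lia)).
    unfold bang_rel in *; lia.
  - apply B; lia.
Qed.

Lemma bang_realized n : forall s F al be,
  bang n F -> total F n = s -> 0 <= al -> al < be -> be <= 1 ->
  exists A, packed al be A /\ length A = n /\ forall i j, (i < j < n)%nat -> F i j = sig A i j.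
Proof.
  induction n as [n IHn] using lt_wf_ind; induction s as [s IHs] using lt_wf_ind.
  intros F al be B E H0 L H1.
  destruct (Nat.eq_dec n 0) as [->|N0].
  { exists nil; repeat split; try contradiction; [constructor|intros; lia]. }
  destruct (Nat.eq_dec n 1) as [->|N1].
  { destruct (standard_single al be H0 L H1) as (f & Sf & If).
    exists (f :: nil); split; [|split; [reflexivity|intros; lia]].
    split; [intros g [<-|[]]; auto|repeat constructor]. }
  destruct (classic (exists k, splitpt n F k)) as [(k & [Lk1 Lk2] & Z)|Ns].
  - set (mu := (al + be)/2); assert (Lm : al < mu < be) by (unfold mu; lra); clearbody mu.
    destruct (IHn k ltac:(lia) (total F k) F al mu) as (A1 & P1 & L1 & Q1); auto; try lra.
    { intros a b c Lab Lc; apply B; lia. }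
    destruct (IHn (n - k)%nat ltac:(lia) (total (fun i j => F (k + i)%nat (k + j)%nat) (n - k)) (fun i j => F (k + i)%nat (k + j)%nat) mu be)
      as (A2 & P2 & L2 & Q2); auto; try lra.
    { intros a b c Lab Lc; apply B; lia. }
    destruct P1 as [S1 O1], P2 as [S2 O2].
    exists (A1 ++ A2); split; [split|split].
    + intros f If; apply in_app_iff in If; destruct If as [If|If].
      * destruct (S1 f If) as (Sf & x & y & Ef & K1 & K2); split; [auto|exists x, y; split; [auto|lra]].
      * destruct (S2 f If) as (Sf & x & y & Ef & K1 & K2); split; [auto|exists x, y; split; [auto|lra]].
    + apply ForallOrdPairs_app; auto.
      intros f g If Ig; destruct (S1 f If), (S2 g Ig); eapply good_pair_apart; eauto.
    + rewrite length_app; lia.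
    + intros i j Lij; unfold sig; destruct (Nat.lt_ge_cases j k) as [Lj|Lj].
      * rewrite !app_nth1 by lia; apply Q1; lia.
      * rewrite (@app_nth2 _ A1 A2 mf_default j) by lia; destruct (Nat.lt_ge_cases i k) as [Li|Li].
        -- rewrite app_nth1 by lia; rewrite Z by lia.
           destruct (S1 (nth i A1 mf_default)) as (Sf & x & y & Ef & K1 & K2); [apply nth_In; lia|].
           destruct (S2 (nth (j - length A1) A2 mf_default)) as (Sg & x' & y' & Eg & K1' & K2');
             [apply nth_In; lia|].
           symmetry; apply sll_osc; auto; apply (sll_ends _ _ _ _ _ _ Ef Eg); lra.
        -- rewrite app_nth2 by lia; rewrite L1.
           specialize (Q2 (i - k)%nat (j - k)%nat ltac:(lia)); unfold sig in Q2.
           replace (k + (i - k))%nat with i in Q2 by lia.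
           replace (k + (j - k))%nat with j in Q2 by lia; exact Q2.
  - destruct n as [|m]; [lia|].
    assert (P : forall i, (i < m)%nat -> (0 < F i m)%nat).
    { intros i Li; apply indecomposable_pos; auto; intros k Hk; apply Ns; eauto. }
    set (al' := al + (be - al)/3); set (be' := be - (be - al)/3).
    assert (K : al < al' /\ al' < be' /\ be' < be) by (unfold al', be'; lra); clearbody al' be'.
    destruct (IHs (total (rot F m) (S m))) with (F := rot F m) (al := al') (be := be')
      as (A & PA & LA & QA); auto; try lra.
    { subst s; apply total_rot; auto; lia. }
    { apply bang_rot; auto. }
    destruct A as [|h A]; [discriminate|]; simpl in LA.
    destruct (nest_exists al be al' be' h A) as (c & Sc & Ic & Cc & Gc); auto; try lra.
    destruct PA as [SA OA].
    inversion OA as [|? ? Oh OA']; subst; rewrite Forall_forall in Oh.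
    exists (A ++ c :: nil); split; [split|split].
    + intros f If; apply in_app_iff in If; destruct If as [If|[<-|[]]]; [|auto].
      destruct (SA f (or_intror If)) as (Sf & x & y & Ef & K1 & K2).
      split; [auto|exists x, y; split; [auto|lra]].
    + apply ForallOrdPairs_app; [auto|repeat constructor|].
      intros f g If [<-|[]]; apply Gc; exact If.
    + rewrite length_app; simpl; lia.
    + assert (m = length A) as -> by lia.
      intros i j Lij; unfold sig; rewrite (app_nth1 A) by lia.
      assert (Ii : In (nth i A mf_default) A) by (apply nth_In; lia).
      destruct (Nat.eq_dec j (length A)) as [->|Nj].
      * rewrite nth_middle.
        destruct (Gc _ Ii) as (Sub & _ & Pc & _).
        destruct (SA _ (or_intror Ii)) as (Sf & _).
        destruct (SA h (or_introl eq_refl)) as (Sh & x & y & Eh & _).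
        destruct (Oh _ Ii) as (Lh & _).
        rewrite (osc_circ _ c h); auto using std_pair_noclash.
        specialize (QA 0%nat (S i) ltac:(lia)); simpl in QA; rewrite Nat.sub_0_r in QA.
        unfold sig in QA; simpl in QA; specialize (P i ltac:(lia)); lia.
      * rewrite app_nth1 by lia.
        specialize (QA (S i) (S j) ltac:(lia)); simpl in QA; rewrite Nat.sub_0_r in QA.
        exact QA.
Qed.

Theorem theorem5p8 :
  (forall (n : nat) (F : nat -> nat -> nat),
     bang n F <->
     exists A : list MF, in_S A /\ length A = n /\
       forall i j, (i < j < n)%nat -> F i j = sig A i j)
  /\
  (forall (A' : list MF) (amax : MF), in_S (A' ++ amax :: nil) ->
     (forall h : MF, circ amax h ->
        (exists i, (i < length A')%nat /\ (0 < osc (nth i A' mf_default) amax)%nat) ->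
        exists L : list MF, Permutation L (A' ++ h :: nil) /\
          (forall i j, (i < j < length L)%nat ->
             slt (nth i L mf_default) (nth j L mf_default)) /\
          rotrel (length (A' ++ amax :: nil)) (sig (A' ++ amax :: nil))
                 (length L) (sigZ L))
     /\
     ((forall i, (i < length A')%nat -> osc (nth i A' mf_default) amax = 0%nat) ->
        exists L : list MF, Permutation L A' /\
          (forall i j, (i < j < length L)%nat ->
             slt (nth i L mf_default) (nth j L mf_default)) /\
          rotrel (length (A' ++ amax :: nil)) (sig (A' ++ amax :: nil))
                 (length L) (sigZ L))).
Proof.
  split.
  - intros n F; split.
    + intros B.
      destruct (bang_realized n _ F 0 1 B eq_refl) as (A & P & L & E); try lra.
      exists A; split; [exact (packed_in_S _ _ _ P)|auto].
    + intros (A & HA & L & E); exact (sig_bang n F A HA L E).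
  - intros A c HA; split.
    + intros h Hc Hex; exact (rotation_pos A c HA h Hc Hex).
    + intros Z; exists A; split; [apply Permutation_refl|split].
      * intros i j Lij; apply (pair_a A c HA i j Lij).
      * exact (rotation_zero A c HA Z).
Qed.
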